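(* Let $X$ be a finite connected CW complex of dimension $d\ge 1$ equipped with a choice of finite signed sets $X(\alpha,j)$ as in the context, let $z_0\in Z_{d-1}(X;\mathbb Z)$, $\beta>0$, and let $(\tau_D,\gamma)$ be a periodic driving protocol, $\gamma(t)=(E(t),W(t))$. Let $\varrho(t)$ be the formal solution of the master equation $\dot p=-\tau_D\mathcal H(t)p$ on the cycle-incidence graph $\Gamma=\Gamma_{X,z_0}$ with initial value $\varrho(0)=z_0$ (the distribution concentrated at the vertex $z_0$). Then its expectation $$\rho(t):=\mathbb E[\varrho(t)]=\sum_{z\in\Gamma_0}\varrho(t)(z)\,z\ \in Z_{d-1}(X;\mathbb R)$$ is the unique solution to the dynamical equation $$\dot q=-\tau_D H(t)\,q,\qquad H(t)=\partial\, e^{-\beta W(t)}\,\partial^*\, e^{\beta E(t)}\colon C_{d-1}(X;\mathbb R)\to C_{d-1}(X;\mathbb R),$$ with respect to the initial condition $\rho(0)=z_0$.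
   Context: **Chains.** $X_k$ is the set of (oriented) $k$-cells of $X$; $C_k(X;A)$ is the free $A$-module on $X_k$ (cellular chains) with boundary $\partial$; $Z_k$, $B_k$ denote cellular cycles and boundaries. $\langle-,-\rangle$ is the standard inner product making $X_k$ an orthonormal basis; $\partial^*$ is the adjoint of $\partial$ for the standard inner products. $b_{\alpha,j}=\langle\partial\alpha,j\rangle$. **Auxiliary structure.** For every $d$-cell $\alpha$ and $(d-1)$-cell $j$ a finite set $X(\alpha,j)$ and a function $\chi\colon X(\alpha,j)\to\{0,1\}$ are fixed such that $b_{\alpha,j}=\sum_{\varepsilon\in X(\alpha,j)}(-1)^{\chi(\varepsilon)}$. **Driving protocol.** $\mathcal M_X$ is the real vector space of pairs $(E,W)$ of functions $E\colon X_{d-1}\to\mathbb R$, $W\colon X_d\to\mathbb R$. A periodic driving protocol is a pair $(\tau_D,\gamma)$ with $\tau_D>0$ and $\gamma$ a smooth $1$-periodic map to $\mathcal M_X$, $\gamma(t)=(E(t),W(t))$. $e^{\beta E}$ and $e^{\beta W}$ are the diagonal operators $j\mapsto e^{\beta E_j}j$ on $C_{d-1}(X;\mathbb R)$ and $\alpha\mapsto e^{\beta W_\alpha}\alpha$ on $C_d(X;\mathbb R)$. **Cycle-incidence graph.** Let $G$ be the directed graph with vertex set $z_0+B_{d-1}(X;\mathbb Z)$, whose directed edges with source $z$ are the $4$-tuples $e=(\alpha,f,\varepsilon,z)$ with $\alpha\in X_d$, $f\in X_{d-1}$, $\varepsilon\in X(\alpha,f)$, $\langle z,f\rangle\ne0$,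 $\langle\partial\alpha,f\rangle\neq 0$; $s(e)=z$, and the target of $e$ is $t(e)=z-(-1)^{\chi(\varepsilon)}\langle z,f\rangle\,\partial\alpha$. $\Gamma=\Gamma_{X,z_0}$ is the subgraph of vertices and edges lying on finite directed paths starting at $z_0$; $\Gamma_0,\Gamma_1$ are its vertices and directed edges. The rate of $e=(\alpha,f,\varepsilon,z)$ at time $t$ is $k_{\alpha,f}(t)=e^{\beta(E_f(t)-W_\alpha(t))}$; write $(\alpha_e,f_e)$ for the pair $(\alpha,f)$ of the edge $e$. **Master operator.** For $w\in\Gamma_0$, $\mathcal H(w)=\sum_{e\in\Gamma_1,\,s(e)=w}k_{\alpha_e,f_e}\,(w-t(e))$, a formal linear combination of vertices of $\Gamma$; $\mathcal H_{z,w}$ is the coefficient of $z$ in $\mathcal H(w)$. $\mathcal H$ is extended to distributions, i.e. functions $p\colon\Gamma_0\to\mathbb R$ ($0$-cochains), by $\mathcal H(p)(z)=\sum_{w\in\Gamma_0}\mathcal H_{z,w}\,p(w)$. **Formal solution.** The formal solution of the master equation is the one given by perturbation theory: put $A=-\tau_D\mathcal H=A^0+A^1$ with $A^0$ diagonal and $A^1$ zero on the diagonal, let $p_0$ be the distribution with $p_0(z_0)=1$ and $p_0(z)=0$ for $z\neq z_0$, substitute a series $p^0+\epsilon p^1+\epsilon^2p^2+\cdots$, with $\dot p^0=A^0p^0$, into the equation $\dot p=(A^0+\epsilon A^1)p$, $p(0)=p_0$, equate the coefficients of the powers of $\epsilon$, and set $\epsilon=1$. *)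

(* Defs.v *)
From HB Require Import structures.
From mathcomp Require Import all_boot all_order all_algebra.
From mathcomp Require Import all_classical all_reals all_analysis.
Set Implicit Arguments.
Unset Strict Implicit.
Unset Printing Implicit Defensive.
Import Order.TTheory GRing.Theory Num.Theory.
Import numFieldNormedType.Exports.
Local Open Scope classical_set_scope.
Local Open Scope ring_scope.

(* The model of the closed k-disk is the cube [-1, 1]^k (the unit ball of the
   sup norm), so that a characteristic map is itself a singular k-cube. *)
Definition cube (R : realType) (k : nat) : set 'rV[R]_k :=
  [set u | forall i, -1 <= u 0 i <= 1].

Definition open_cube (R : realType) (k : nat) : set 'rV[R]_k :=
  [set u | forall i, -1 < u 0 i < 1].

(* A finite CW complex of dimension d: a Hausdorff space which is the disjoint
   union of finitely many open cells, each parametrized by the interior of a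
   disk whose boundary is attached to cells of smaller dimension. Finiteness
   makes the weak topology condition automatic, and compactness makes each
   open cell homeomorphic to the open disk. *)
Record finCW (R : realType) (d : nat) := FinCW {
  cw_space :> topologicalType;
  cw_hausdorff : hausdorff_space cw_space;
  cell : nat -> finType;
  cell_dim : (0 < #|cell d|)%N;
  cell_gt_dim : forall k, (d < k)%N -> #|cell k| = 0%N;
  char_map : forall k, cell k -> 'rV[R]_k -> cw_space;
  char_map_continuous : forall k (a : cell k),
    {within @cube R k, continuous (char_map a)};
  char_map_inj : forall k (a : cell k),
    {in @open_cube R k &, injective (char_map a)};
  cell_disjoint : forall k (a : cell k) l (b : cell l),
    (char_map a @` @open_cube R k) `&` (char_map b @` @open_cube R l) !=set0 ->
    Tagged cell a = Tagged cell b;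
  cell_cover : forall x : cw_space, exists k (a : cell k),
    (char_map a @` @open_cube R k) x;
  cell_attach : forall k (a : cell k) u,
    (@cube R k `\` @open_cube R k) u ->
    exists l (b : cell l),
      (l < k)%N /\ (char_map b @` @open_cube R l) (char_map a u) }.

Arguments cell {R d} X k : rename.
Arguments char_map {R d} X {k} a u : rename.

(* skeleton_lt X k is the (k-1)-skeleton of X, and the empty set for k = 0. *)
Definition skeleton_lt (R : realType) (d : nat) (X : finCW R d) (k : nat) :
    set X :=
  [set x | exists l (a : cell X l),
    (l < k)%N /\ (char_map X a @` @open_cube R l) x].

(* Singular cubical chains. A chain is a formal sum of pairs (coefficient,
   cube); only the values of a cube on [-1, 1]^k matter, and chains are
   compared modulo degenerate cubes. *)
Section CubicalChains.
Variables (R : realType) (T : topologicalType).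

Definition scube k := 'rV[R]_k -> T.

Definition cubical_chain k := seq (int * scube k).

Definition cube_in (A : set T) k (s : scube k) : Prop :=
  {within @cube R k, continuous s} /\ (forall u, cube u -> A (s u)).

Definition cube_eq k (s s' : scube k) : Prop :=
  forall u, @cube R k u -> s u = s' u.

Definition degenerate k (s : scube k) : Prop :=
  exists i : 'I_k, forall u v, @cube R k u -> @cube R k v ->
    (forall j, j != i -> u 0 j = v 0 j) -> s u = s v.

Definition chain_in (A : set T) k (c : cubical_chain k) : bool :=
  all (fun x => `[< cube_in A x.2 >]) c.

Definition coefficient k (c : cubical_chain k) (s : scube k) : int :=
  \sum_(x <- c | `[< cube_eq x.2 s >]) x.1.

Definition chain_eq k (c c' : cubical_chain k) : Prop :=
  forall s, ~ degenerate s -> coefficient c s = coefficient c' s.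

Definition face k (i : 'I_k.+1) (r : R) (s : scube k.+1) : scube k :=
  fun u => s (\row_j (if unlift i j is Some l then u 0 l else r)).

Definition cubical_boundary k (c : cubical_chain k.+1) : cubical_chain k :=
  flatten [seq flatten [seq [:: ((-1) ^+ (val i) * x.1, face i 1 x.2);
                                (- ((-1) ^+ (val i) * x.1), face i (-1) x.2)]
                       | i <- enum 'I_k.+1]
          | x <- c].

End CubicalChains.

(* The cellular chain complex of X. Its k-chains are identified with the free
   module on the k-cells, the cell a (oriented by its characteristic map)
   standing for the class of that map in H_k(X^k, X^(k-1)). The field
   incidenceP says that the matrix of the boundary is that of the connecting
   map H_(k+1)(X^(k+1), X^k) -> H_k(X^k, X^(k-1)): the boundary of the
   characteristic cube of a is homologous in X^k, modulo X^(k-1), to the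
   combination of the characteristic cubes of the k-cells j with coefficients
   incidence a j. This determines incidence and implies incidence_incidence,
   which is kept as a field as part of being a chain complex. *)
Record cellular_complex (R : realType) (d : nat) (X : finCW R d) :=
  CellularComplex {
  incidence : forall k, cell X k.+1 -> cell X k -> int;
  incidenceP : forall k (a : cell X k.+1),
    exists (u : cubical_chain R X k.+1) (v : cubical_chain R X k),
      [/\ chain_in (@skeleton_lt R d X k.+1) u,
          chain_in (@skeleton_lt R d X k) v &
          chain_eq (cubical_boundary [:: (1, char_map X a)])
            ([seq (incidence a j, char_map X j) | j <- enum (cell X k)]
               ++ cubical_boundary u ++ v)];
  incidence_incidence : forall k (a : cell X k.+2) (i : cell X k),
    \sum_(j : cell X k.+1) incidence a j * incidence j i = 0 }.

Arguments incidence {R d X} C {k} a j : rename.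

Notation chains X k A := {ffun cell X k -> A}.

Section Chains.
Variables (R : realType) (d : nat) (X : finCW R d) (C : cellular_complex X).

Definition bdry (A : pzRingType) k (c : chains X k.+1 A) : chains X k A :=
  [ffun j => \sum_(a : cell X k.+1) c a * (incidence C a j)%:~R].

Definition bdry_cell k (a : cell X k.+1) : chains X k int :=
  [ffun j => incidence C a j].

Definition cycles (A : pzRingType) k : set (chains X k A) :=
  match k with
  | 0%N => setT
  | k'.+1 => [set c | bdry c = 0]
  end.

Definition boundaries (A : pzRingType) k : set (chains X k A) :=
  range (@bdry A k).

Definition chain_of_int k (z : chains X k int) : chains X k R :=
  [ffun j => (z j)%:~R].

Definition inner k (x y : chains X k R) : R := \sum_(j : cell X k) x j * y j.

Definition coboundary k (y : chains X k R) : chains X k.+1 R :=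
  [ffun a => inner (chain_of_int (bdry_cell a)) y].

Lemma bdry_delta k (a : cell X k.+1) :
  bdry [ffun b => (b == a)%:R] = bdry_cell a.
Proof.
apply/ffunP => j; rewrite !ffunE (bigD1 a) //= ffunE eqxx mul1r intz.
by rewrite big1 ?addr0 // => b /negbTE ba; rewrite ffunE ba mul0r.
Qed.

Lemma coboundary_adjoint k (x : chains X k.+1 R) (y : chains X k R) :
  inner (bdry x) y = inner x (coboundary y).
Proof.
rewrite /inner; under eq_bigr => j _ do rewrite ffunE big_distrl /=.
rewrite exchange_big; apply: eq_bigr => a _.
rewrite ffunE /inner big_distrr; apply: eq_bigr => j _.
by rewrite !ffunE /= mulrA.
Qed.

Definition exp_diag k (beta : R) (E : cell X k -> R) (x : chains X k R) :
    chains X k R :=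
  [ffun j => expR (beta * E j) * x j].

End Chains.

Arguments cycles {R d X} C A k.

Definition smooth (R : realType) (f : R -> R) : Prop :=
  forall (m : nat) (t : R), derivable (derive1n m f) t 1.

Record driving_protocol (R : realType) (n : nat) (X : finCW R n.+1) :=
  DrivingProtocol {
  tauD : R;
  tauD_gt0 : 0 < tauD;
  protocol : R -> {ffun cell X n -> R} * {ffun cell X n.+1 -> R};
  protocol_smooth :
    (forall j, smooth (fun t => (protocol t).1 j)) /\
    (forall a, smooth (fun t => (protocol t).2 a));
  protocol_periodic : forall t, protocol (t + 1) = protocol t }.

Record signed_sets (R : realType) (n : nat) (X : finCW R n.+1)
    (C : cellular_complex X) := SignedSets {
  signed_set : cell X n.+1 -> cell X n -> finType;
  chi : forall a j, signed_set a j -> bool;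
  signed_setP : forall a j,
    incidence C a j = \sum_(e : signed_set a j) (-1) ^+ chi e }.

Arguments chi {R n X C} S {a j} e : rename.

(* The sum of an absolutely convergent family of reals; the value is
   meaningless if the family is not summable. *)
Definition asum (R : realType) (I : choiceType) (f : I -> R) : R :=
  fine (\esum_(i in [set: I]) ((EFin \o f)^\+ i)%E)
  - fine (\esum_(i in [set: I]) ((EFin \o f)^\- i)%E).

Section CycleIncidenceGraph.
Variables (R : realType) (n : nat) (X : finCW R n.+1).
Variables (C : cellular_complex X) (S : signed_sets C).
Variable z0 : chains X n int.

Definition graph_vertex : set (chains X n int) :=
  [set z | exists2 b, boundaries C b & z = z0 + b].

(* An edge (alpha, f, epsilon, z) is the pair of its label
   ((alpha, f), epsilon) and of its source z. *)
Definition label : finType :=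
  {af : cell X n.+1 * cell X n & signed_set S af.1 af.2}.

Definition edge := (label * chains X n int)%type.

Definition edge_alpha (e : edge) : cell X n.+1 := (tag e.1).1.
Definition edge_f (e : edge) : cell X n := (tag e.1).2.
Definition edge_sign (e : edge) : int := (-1) ^+ chi S (tagged e.1).

Definition source (e : edge) : chains X n int := e.2.

Definition target (e : edge) : chains X n int :=
  source e - bdry_cell C (edge_alpha e)
             *~ (edge_sign e * source e (edge_f e)).

Definition graph_edge : set edge :=
  [set e | [/\ graph_vertex (source e), source e (edge_f e) != 0 &
               incidence C (edge_alpha e) (edge_f e) != 0]].

Fixpoint directed_path (z : chains X n int) (es : seq edge) : Prop :=
  match es with
  | [::] => True
  | e :: es' => [/\ graph_edge e, source e = z & directed_path (target e) es']
  end.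

Definition Gamma0 : set (chains X n int) :=
  [set z | exists2 es, directed_path z0 es & z \in z0 :: map target es].

Definition Gamma1 : set edge :=
  [set e | exists2 es, directed_path z0 es & e \in es].

Definition vertex_distribution := Gamma0 -> R.

Variables (beta : R) (D : driving_protocol X).

Definition rate (t : R) (e : edge) : R :=
  expR (beta * ((protocol D t).1 (edge_f e) - (protocol D t).2 (edge_alpha e))).

(* The edges with source w are the (l, w), for l a label. *)
Definition master_coef (t : R) (z w : Gamma0) : R :=
  \sum_(l : label | (l, val w) \in Gamma1)
    rate t (l, val w)
      * ((val z == val w)%:R - (val z == target (l, val w))%:R).

Definition Acoef (t : R) (z w : Gamma0) : R := - tauD D * master_coef t z w.
Definition A0coef t (z w : Gamma0) : R := if z == w then Acoef t z w else 0.
Definition A1coef t (z w : Gamma0) : R := if z == w then 0 else Acoef t z w.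

Definition apply_op (M : Gamma0 -> Gamma0 -> R) (p : vertex_distribution) :
    vertex_distribution :=
  fun z => asum (fun w => M z w * p w).

Definition initial_distribution : vertex_distribution :=
  fun z => (val z == z0)%:R.

(* p m is the coefficient of eps^m: the equations are those between the
   coefficients of eps^m in p' = (A^0 + eps A^1) p and in p(0) = p_0. *)
Definition perturbation_series (p : nat -> R -> vertex_distribution) : Prop :=
  (forall m z, p m 0 z = if m is 0%N then initial_distribution z else 0) /\
  (forall m t z, is_derive t (1 : R) (fun s => p m s z)
    (apply_op (A0coef t) (p m t) z
     + (if m is m'.+1 then apply_op (A1coef t) (p m' t) z else 0))).

Definition formal_solution (rho : R -> vertex_distribution) : Prop :=
  exists2 p, perturbation_series p &
    forall t z, series (fun m => p m t z) @ \oo --> rho t z.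

Definition expectation_summable (p : vertex_distribution) : Prop :=
  forall j, summable [set: Gamma0] (fun z => (p z * (val z j)%:~R)%:E).

Definition vertex_expectation (p : vertex_distribution) : chains X n R :=
  [ffun j => asum (fun z : Gamma0 => p z * (val z j)%:~R)].

End CycleIncidenceGraph.

Section Dynamics.
Variables (R : realType) (n : nat) (X : finCW R n.+1).
Variables (C : cellular_complex X) (beta : R) (D : driving_protocol X).

Definition dyn_op (t : R) (q : chains X n R) : chains X n R :=
  bdry C (exp_diag (- beta) (protocol D t).2
    (coboundary C (exp_diag beta (protocol D t).1 q))).

Definition dynamical_solution (z0 : chains X n int) (q : R -> chains X n R) :
    Prop :=
  q 0 = chain_of_int z0 /\
  forall t j, is_derive t (1 : R) (fun s => q s j)
    (- tauD D * dyn_op t (q t) j).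

End Dynamics.

(* Main.v *)
(* A path of the graph from z_0 is listed by its edge labels. Expanding the
   formal solution over paths, the weight p_ls of a path solves the scalar
   linear equation driven by the weight of the path without its last edge. The
   rates are periodic, hence bounded, so Gronwall's inequality makes the weights
   of the paths of length m at most th^m e^(l|t|), with th arbitrarily small
   once l is large. There are at most N^m such paths, and their endpoints grow
   at most like L^m; with th = 1/(2NL), the whole expansion, together with its
   first moment, is dominated by a geometric series. So the expectation is the
   locally uniform limit of its partial sums over paths of length at most m,
   which can be differentiated term by term. The average drift at a vertex z is
   -tau_D H(t) z, since the signs of the set X(alpha, f) add up to the incidence
   number; by linearity the expectation solves the dynamical equation, whose
   solution is unique. *)
Require Import Defs.
From HB Require Import structures.
From mathcomp Require Import all_boot all_order all_algebra.
From mathcomp Require Import all_classical all_reals all_analysis.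
From mathcomp Require Import ring lra.
Set Implicit Arguments.
Unset Strict Implicit.
Unset Printing Implicit Defensive.
Import Order.TTheory GRing.Theory Num.Theory.
Import numFieldNormedType.Exports.
Local Open Scope classical_set_scope.
Local Open Scope ring_scope.

(** * Real differential equations *)

Section RealAnalysis.
Variable R : realType.
Implicit Types (f g : R -> R) (t : R).

Lemma is_derive1_continuous f f' : (forall t, is_derive t (1 : R) f (f' t)) ->
  continuous f.
Proof.
move=> df t; apply/differentiable_continuous/derivable1_diffP.
exact: (@ex_derive _ _ _ _ _ _ _ (df t)).
Qed.

Lemma is_derive1_reflect f (f' : R) t : is_derive (- t) (1 : R) f f' ->
  is_derive t (1 : R) (fun s => f (- s)) (- f').
Proof.
by move=> df; rewrite -mulN1r mulrC; exact: is_derive1_comp.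
Qed.

Lemma is_derive1_mul f g t (f' g' : R) :
  is_derive t (1 : R) f f' -> is_derive t (1 : R) g g' ->
  is_derive t (1 : R) (fun s => f s * g s) (f t * g' + g t * f').
Proof. by move=> df dg; exact: is_deriveM. Qed.

Lemma is_derive1_sub f g t (f' g' : R) :
  is_derive t (1 : R) f f' -> is_derive t (1 : R) g g' ->
  is_derive t (1 : R) (fun s => f s - g s) (f' - g').
Proof. by move=> df dg; exact: is_deriveB. Qed.

Lemma is_derive1_sum (I : Type) (s : seq I) (h : I -> R -> R) (h' : I -> R) t :
  (forall i, is_derive t (1 : R) (h i) (h' i)) ->
  is_derive t (1 : R) (fun u => \sum_(i <- s) h i u) (\sum_(i <- s) h' i).
Proof.
move=> dh; elim: s => [|i s IHs].
  rewrite big_nil (_ : (fun _ => _) = cst 0); first exact: is_derive_cst.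
  by apply/funext => u; rewrite big_nil.
rewrite big_cons (_ : (fun _ => _) = h i + (fun u => \sum_(j <- s) h j u)).
  exact: is_deriveD.
by apply/funext => u; rewrite big_cons.
Qed.

Lemma is_derive1_expRM f t (f' : R) : is_derive t (1 : R) f f' ->
  is_derive t (1 : R) (fun s => expR (f s)) (f' * expR (f t)).
Proof. by move=> df; rewrite mulrC; exact: is_derive1_comp. Qed.

Lemma is_derive1_scale (c t : R) : is_derive t (1 : R) (fun s => c * s) c.
Proof.
apply: (is_derive_eq (is_derive1_mul (is_derive_cst c t 1) (is_derive_id t 1))).
by rewrite mulr1 mulr0 addr0.
Qed.

(** The integrating factor [expR (- k * t)] turns [D] into a nondecreasing function on the
    nonnegative half-line. *)
Lemma gronwall_ge0 (D d : R -> R) (k : R) :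
  (forall t, 0 <= t -> is_derive t (1 : R) D (d t)) -> 0 <= D 0 ->
  (forall t, 0 <= t -> k * D t <= d t) ->
  forall t, 0 <= t -> 0 <= D t.
Proof.
move=> dD D0 kD t t0; pose h (s : R) := expR (- k * s) * D s.
have dh (s : R) : 0 <= s -> is_derive s (1 : R) h (expR (- k * s) * (d s - k * D s)).
  move=> s0; have dE := is_derive1_expRM (is_derive1_scale (- k) s).
  by apply: (is_derive_eq (is_derive1_mul dE (dD s s0))); ring.
suff : h 0 <= h t.
  rewrite /h mulr0 expR0 mul1r => ht; rewrite -(pmulr_rge0 _ (expR_gt0 (- k * t))).
  exact: le_trans ht.
apply: (@ger0_derive1_ndecry _ h 0) => // [s||].
- by rewrite in_itv /= andbT => /ltW /dh ds; exact: ex_derive.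
- move=> s; rewrite in_itv /= andbT => /ltW s0.
  rewrite derive1E (@derive_val _ _ _ _ _ _ _ (dh s s0)) mulr_ge0 ?expR_ge0//.
  by rewrite subr_ge0 kD.
- apply: derivable_within_continuous => s.
  by rewrite in_itv /= andbT => /dh ds; exact: ex_derive.
Qed.

Lemma gronwall_ge0_sym (D d : R -> R) (k : R) :
  (forall t, is_derive t (1 : R) D (d t)) -> 0 <= D 0 ->
  (forall t, 0 <= t -> k * D t <= d t) ->
  (forall t, t <= 0 -> k * D t <= - d t) ->
  forall t, 0 <= D t.
Proof.
move=> dD D0 kp kn t; have [t0|/ltW t0] := leP 0 t; first exact: gronwall_ge0 kp _ t0.
rewrite -(opprK t).
apply: (@gronwall_ge0 (fun s => D (- s)) (fun s => - d (- s)) k); rewrite ?oppr0 ?oppr_ge0//.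
- by move=> s _; exact: is_derive1_reflect.
- by move=> s s0; apply: kn; rewrite oppr_le0.
Qed.

(* The square of [p] is compared with that of the bound, which is
   differentiable on each side of 0. *)
Lemma gronwall_exp (p p' : R -> R) (K c l : R) :
  (forall t, is_derive t (1 : R) p (p' t)) -> 0 <= K <= l -> 0 <= c ->
  `|p 0| <= c ->
  (forall t, `|p' t| <= K * `|p t| + c * (l - K) * expR (l * `|t|)) ->
  forall t, `|p t| <= c * expR (l * `|t|).
Proof.
move=> dp /andP[K0 Kl] c0 p0 p'le.
have half (q q' : R -> R) : (forall t, is_derive t (1 : R) q (q' t)) -> `|q 0| <= c ->
    (forall t, 0 <= t -> `|q' t| <= K * `|q t| + c * (l - K) * expR (l * t)) ->
    forall t, 0 <= t -> `|q t| <= c * expR (l * t).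
  move=> dq q0 q'le t t0.
  have cE : 0 <= c * expR (l * t) by rewrite mulr_ge0 ?expR_ge0.
  rewrite -(ger0_norm cE) -ler_sqr ?nnegrE// ?normr_ge0//.
  rewrite !real_normK ?num_real// -subr_ge0.
  pose E (s : R) := expR (l * s).
  have dE (s : R) : is_derive s (1 : R) E (l * E s).
    by apply: is_derive1_expRM; exact: is_derive1_scale.
  pose W (s : R) := c * E s.
  have dW (s : R) : is_derive s (1 : R) W (l * W s).
    apply: (is_derive_eq (is_derive1_mul (is_derive_cst c s 1) (dE s))).
    by rewrite /W /=; ring.
  (* The rate [l + K] comes from 2|q|W <= q^2 + W^2: the derivative of W^2 - q^2 is at least 2lW^2 -
     2Kq^2 - (l - K)(q^2 + W^2), which is (l + K)(W^2 - q^2). *)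
  apply: (@gronwall_ge0 (fun s => W s ^+ 2 - q s ^+ 2)
    (fun s => 2 * l * W s ^+ 2 - 2 * (q s * q' s)) (l + K)) => //.
  - move=> s _.
    have dB := is_derive1_sub (is_derive1_mul (dW s) (dW s))
                          (is_derive1_mul (dq s) (dq s)).
    by apply: (is_derive_eq dB); ring.
  - rewrite /W /E mulr0 expR0 mulr1 subr_ge0 -(real_normK (num_real (q 0))).
    by rewrite ler_sqr ?nnegrE.
  move=> s s0; have Ws : 0 <= W s by rewrite mulr_ge0 ?expR_ge0.
  have qq : q s * q' s <= K * q s ^+ 2 + (l - K) * (`|q s| * W s).
    rewrite (le_trans (ler_norm _))// normrM -(real_normK (num_real (q s))).
    have := ler_wpM2l (normr_ge0 (q s)) (q'le s s0).
    by move/le_trans; apply; rewrite le_eqVlt /W /E; apply/predU1P; left; ring.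
  have qW : 2 * (`|q s| * W s) <= q s ^+ 2 + W s ^+ 2.
    rewrite -(real_normK (num_real (q s))) -subr_ge0.
    rewrite (_ : _ - _ = (`|q s| - W s) ^+ 2) ?sqr_ge0//; ring.
  have lK : 0 <= l - K by rewrite subr_ge0.
  have := ler_wpM2l lK qW; nra.
move=> t; have [t0|t0] := leP 0 t.
  rewrite (ger0_norm t0); apply: (half p p' dp p0) t0 => s s0.
  by have := p'le s; rewrite (ger0_norm s0).
rewrite -{1}(opprK t) (ltr0_norm t0).
apply: (half (fun s => p (- s)) (fun s => - p' (- s))).
- by move=> s; exact: is_derive1_reflect.
- by rewrite oppr0.
- by move=> s s0; have := p'le (- s); rewrite !normrN (ger0_norm s0).
- by rewrite oppr_ge0 ltW.
Qed.

Lemma mean_value_le f f' (c T : R) :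
  (forall t, is_derive t (1 : R) f (f' t)) ->
  (forall t, `|t| <= T -> `|f' t| <= c) ->
  forall s t, `|s| <= T -> `|t| <= T -> `|f s - f t| <= c * `|s - t|.
Proof.
move=> df f'c.
have wl (s t : R) : s <= t -> `|s| <= T -> `|t| <= T -> `|f t - f s| <= c * `|t - s|.
  move=> st; rewrite !ler_norml => /andP[Ts sT] /andP[Tt tT].
  have fc := continuous_subspaceT (is_derive1_continuous df).
  have [x xst ->] := @MVT_segment _ f f' s t st (fun x _ => df x) (fc _).
  rewrite -ler_norml normrM ler_wpM2r// f'c// ler_norml.
  move: xst; rewrite in_itv /= => /andP[sx xt].
  by rewrite (le_trans Ts)//= (le_trans xt).
move=> s t sT tT; have [st|/ltW ts] := leP s t; last exact: wl.
by rewrite distrC (distrC s); exact: wl.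
Qed.

Lemma cvg_norm_le (u : nat -> R) (l c : R) : u @ \oo --> l ->
  (\forall m \near \oo, `|u m| <= c) -> `|l| <= c.
Proof.
move=> ul uc.
exact: (@closed_cvg _ _ _ _ _ _ (@closed_le _ c) uc _ (cvg_norm ul)).
Qed.

(** The difference quotient of [g] is compared with that of a single [f N]: the mean value theorem
    bounds the increments of [f m - f N], and letting [m] grow gives the same bound for
    [g - f N]. *)
Lemma is_derive1_lim (f f' : nat -> R -> R) (g g' : R -> R) :
  (forall m t, is_derive t (1 : R) (f m) (f' m t)) ->
  (forall t, (fun m => f m t) @ \oo --> g t) ->
  (forall T e : R, 0 < e -> \forall m \near \oo,
     forall t, `|t| <= T -> `|f' m t - g' t| <= e) ->
  forall t, is_derive t (1 : R) g (g' t).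
Proof.
move=> df fg f'g' t.
suff key : (fun h => h^-1 *: ((g \o shift t) (h *: 1) - g t)) @ 0^' --> g' t.
  by split; [apply/cvg_ex; exists (g' t)|apply/cvg_lim].
apply/cvgrPdist_le => /= e e0.
(* The error splits into e/4 for [f' N] against [g'], e/4 for the difference quotient of [f N], and
   e/2 for the increments, as two derivatives within e/4 of [g'] differ by at most e/2. *)
have e4 : 0 < e / 4 by rewrite divr_gt0.
have [N _ HN] := f'g' (`|t| + 1) _ e4.
have /= NN := HN N (leqnn N).
have incr (s : R) : `|s| <= `|t| + 1 ->
    `|(g s - f N s) - (g t - f N t)| <= (e / 2) * `|s - t|.
  move=> sT.
  have c : (fun m => (f m s - f N s) - (f m t - f N t)) @ \oo -->
      (g s - f N s) - (g t - f N t).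
    by apply: cvgB; apply: cvgB; [exact: fg|exact: cvg_cst|exact: fg|exact: cvg_cst].
  apply: (cvg_norm_le c); exists N => // m /= Nm.
  apply: (mean_value_le (fun x => is_derive1_sub (df m x) (df N x)) _ sT).
    move=> x xT; have := HN m Nm x xT; have := NN x xT.
    by rewrite !ler_norml => /andP[a1 a2] /andP[a3 a4]; apply/andP; split; lra.
  by rewrite lerDl.
have /cvgrPdist_le /(_ _ e4) dN :
    (fun h => h^-1 *: ((f N \o shift t) (h *: 1) - f N t)) @ 0^' --> f' N t.
  have [dN <-] := df N t; exact: dN.
near=> h.
have h0 : h != 0 by near: h; exact: nbhs_dnbhs_neq.
have h1 : `|h| <= 1 by near: h; apply: dnbhs0_le.
have := near dN h; rewrite /= /GRing.scale /= mulr1 => /(_ _) dNh.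
have {}dNh : `|f' N t - h^-1 * (f N (h + t) - f N t)| <= e / 4 by exact: dNh.
have /incr : `|h + t| <= `|t| + 1 by rewrite (le_trans (ler_normD _ _))// addrC lerD2l.
rewrite addrK => incrh.
have {}incrh : `|h^-1 * ((g (h + t) - f N (h + t)) - (g t - f N t))| <= e / 2.
  by rewrite normrM normfV mulrC ler_pdivrMr ?normr_gt0.
have := NN t; rewrite lerDl => /(_ ler01).
move: dNh incrh; rewrite !ler_norml => /andP[a1 a2] /andP[b1 b2] /andP[c1 c2].
by apply/andP; split; lra.
Unshelve. all: by end_near. Qed.

(** Integrating from -1 makes 0 an interior point, so that the derivative there is two-sided. *)
Lemma continuous_primitive_right f : continuous f ->
  exists F : R -> R, F 0 = 0 /\ forall t, -1 < t -> is_derive t (1 : R) F (f t).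
Proof.
move=> cf.
pose G x := (\int[@lebesgue_measure R]_(s in [set` `[-1, x]]) f s)%R.
exists (fun x => G x - G 0); split; first by rewrite subrr.
move=> t t1; have tt : t < t + 1 by rewrite ltrDl.
have intf : (@lebesgue_measure R).-integrable `[-1, t + 1] (EFin \o f).
  apply: continuous_compact_integrable; first exact: segment_compact.
  exact: continuous_subspaceT.
have [dG G't] := @continuous_FTC1_closed _ f (-1) t (t + 1) tt intf t1 (cf t).
have dGt : is_derive t (1 : R) G (f t).
  by split; [exact: dG|rewrite -derive1E; exact: G't].
by apply: (is_derive_eq (is_derive1_sub dGt (is_derive_cst (G 0) t 1))); rewrite subr0.
Qed.

(* A primitive on ]-1, +oo[ and a reflected one on ]-oo, 1[ are glued at 0. *)
Lemma continuous_primitive f : continuous f ->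
  exists F : R -> R, F 0 = 0 /\ forall t, is_derive t (1 : R) F (f t).
Proof.
move=> cf; have [P [P0 dP]] := continuous_primitive_right cf.
have cfN : continuous (fun t => f (- t)).
  by move=> t; apply: continuous_comp; [exact: opp_continuous|exact: cf].
have [Q [Q0 dQ]] := continuous_primitive_right cfN.
pose Qr t := - Q (- t).
have dQr (t : R) : t < 1 -> is_derive t (1 : R) Qr (f t).
  move=> t1; have /dQ/is_derive1_reflect dQt : -1 < - t by rewrite ltrN2.
  by apply: (is_derive_eq (is_deriveN dQt)); rewrite /= !opprK.
have PQ (t : R) : -1 < t -> t < 1 -> P t = Qr t.
  move=> t0 t1; have Qr0 : Qr 0 = 0 by rewrite /Qr oppr0 Q0 oppr0.
  pose h s := P s - Qr s.
  have dh (s : R) : -1 < s -> s < 1 -> is_derive s (1 : R) h 0.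
    move=> s0 s1; apply: (is_derive_eq (is_derive1_sub (dP s s0) (dQr s s1))).
    by rewrite subrr.
  have hc (u v : R) : -1 < u -> v < 1 -> {within `[u, v], continuous h}.
    move=> u0 v1; apply: derivable_within_continuous => s.
    rewrite in_itv /= => /andP[us sv].
    by have ds := dh s (lt_le_trans u0 us) (le_lt_trans sv v1); exact: ex_derive.
  apply/eqP; rewrite -subr_eq0 -/(h t).
  have h0 : h 0 = 0 by rewrite /h P0 Qr0 subrr.
  have [t00|/ltW t00] := leP 0 t.
    have hI x : x \in `]0, t[ -> is_derive x (1 : R) h (cst 0 x).
      rewrite in_itv /= => /andP[x0 xt].
      by apply: dh; [exact: lt_trans x0|exact: lt_trans t1].
    have [x _] := MVT_segment t00 hI (hc _ _ (ltrN10 _) t1).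
    by rewrite h0 subr0 mul0r => ->.
  have hI x : x \in `]t, 0[ -> is_derive x (1 : R) h (cst 0 x).
    rewrite in_itv /= => /andP[x0 xt].
    by apply: dh; [exact: lt_trans x0|exact: lt_trans ltr01].
  have [x _] := MVT_segment t00 hI (hc _ _ t0 ltr01).
  by rewrite h0 sub0r mul0r => /eqP; rewrite oppr_eq0.
exists (fun t => if 0 <= t then P t else Qr t); split; first by rewrite lexx.
move=> t; have [t0|t0] := ltP (-1) t.
  apply: near_eq_is_derive (dP t t0).
  near=> s; case: ifPn => // ; rewrite -ltNge => s0.
  by apply: PQ; [near: s; exact: lt_nbhsr|exact: lt_trans ltr01].
apply: near_eq_is_derive (dQr t _); last by rewrite (le_lt_trans t0)// ltrN10.
near=> s; case: ifPn => // s0; exfalso.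
suff : s < 0 by rewrite ltNge s0.
by near: s; apply: lt_nbhsl; rewrite (le_lt_trans t0)// ltrN10.
Unshelve. all: by end_near. Qed.

(** Variation of constants: with A a primitive of [a], the solution is e^A times [c] plus a
    primitive of e^(-A) g. *)
Lemma linear_ode_exists (a g : R -> R) (c : R) : continuous a -> continuous g ->
  exists p : R -> R,
    p 0 = c /\ forall t, is_derive t (1 : R) p (a t * p t + g t).
Proof.
move=> ca cg; have [A [A0 dA]] := continuous_primitive ca.
have dE (t : R) := is_derive1_expRM (dA t).
have dNE (t : R) := is_derive1_expRM (is_deriveN (dA t)).
have cNE : continuous (fun t => expR (- A t) * g t).
  move=> t; have cE : {for t, continuous (fun s => expR (- A s))}.
    exact: (is_derive1_continuous dNE).
  exact: continuousM cE (cg t).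
have [B [B0 dB]] := continuous_primitive cNE.
exists (fun t => expR (A t) * (c + B t)); rewrite A0 B0 expR0 mul1r addr0.
split=> // t; have dcB := is_deriveD (is_derive_cst c t 1) (dB t).
apply: (is_derive_eq (is_derive1_mul (dE t) dcB)).
have EN : expR (A t) * expR (- A t) = 1 by rewrite -expRD subrr expR0.
rewrite -[in RHS](mul1r (g t)) -EN -[(cst c + B) t]/(c + B t).
by ring.
Qed.

(** Energy estimate: the squared norm [u] satisfies |u'| <= 2K|I|u and vanishes at 0, so Gronwall's
    inequality, applied to [- u] in both time directions, forces it to vanish. *)
Lemma linear_system_uniq (I : finType) (M : R -> I -> I -> R) (K : R)
    (q : R -> I -> R) :
  (forall t i j, `|M t i j| <= K) ->
  (forall t i, is_derive t (1 : R) (fun s => q s i) (\sum_j M t i j * q t j)) ->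
  (forall i, q 0 i = 0) -> forall t i, q t i = 0.
Proof.
move=> MK dq q0 t i.
pose u t := \sum_i q t i * q t i.
pose v t := \sum_i (q t i * (\sum_j M t i j * q t j)
                    + q t i * (\sum_j M t i j * q t j)).
have du (s : R) : is_derive s (1 : R) u (v s).
  by apply: is_derive1_sum => j; exact: is_derive1_mul.
have K0 : 0 <= K by exact: le_trans (MK 0 i i).
have vu (s : R) : `|v s| <= 2 * K * #|I|%:R * u s.
  rewrite (le_trans (ler_norm_sum _ _ _))//.
  (* As a double sum the bound is compared term by term, through 2|q_k q_j| <= q_k^2 + q_j^2. *)
  have -> : 2 * K * #|I|%:R * u s =
      \sum_i \sum_j (K * (q s i * q s i) + K * (q s j * q s j)).
    under eq_bigr => k _ do
      rewrite big_split sumr_const -mulr_sumr /= -/(u s) -mulr_natr -mulrA mulrCA.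
    rewrite big_split /= sumr_const -mulr_suml -/(u s) -mulr_natr; ring.
  apply: ler_sum => k _; rewrite -mulr2n -mulr_natl mulr_sumr mulr_sumr.
  rewrite (le_trans (ler_norm_sum _ _ _))//; apply: ler_sum => j _.
  rewrite !normrM normr_nat -(normr_id (q s k)) -(normr_id (q s j)).
  rewrite -[q s k * _]/(q s k ^+ 2) -[q s j * _]/(q s j ^+ 2).
  rewrite -(real_normK (num_real (q s k))) -(real_normK (num_real (q s j))).
  have := MK s k j; have := sqr_ge0 (`|q s k| - `|q s j|).
  have := mulr_ge0 (normr_ge0 (q s k)) (normr_ge0 (q s j)).
  by rewrite !normr_id; nra.
have u_ge0 (s : R) : 0 <= u s by apply: sumr_ge0 => j _; rewrite -expr2 sqr_ge0.
have u0 : u t <= 0.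
  rewrite -oppr_ge0.
  apply: (@gronwall_ge0_sym (fun s => - u s) (fun s => - v s)
    (2 * K * #|I|%:R) (fun s => is_deriveN (du s))).
  - by rewrite oppr_ge0 /u big1// => j _; rewrite q0 mul0r.
  - by move=> s _; have := vu s; rewrite ler_norml mulrN lerN2 => /andP[].
  - by move=> s _; have := vu s; rewrite ler_norml mulrN opprK => /andP[].
have : \sum_i q t i * q t i == 0 by rewrite -/(u t) eq_le u0 u_ge0.
rewrite psumr_eq0 => [/allP/(_ i (mem_index_enum i))|j _]; last first.
  by rewrite -expr2 sqr_ge0.
by rewrite mulf_eq0 orbb => /eqP.
Qed.

(** Every value is taken at a fractional part, hence on the compact interval [0, 1]. *)
Lemma periodic_bounded f : continuous f -> (forall t, f (t + 1) = f t) ->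
  exists K, forall t, `|f t| <= K.
Proof.
move=> cf f1.
have fnat k (t : R) : f (t + k%:R) = f t.
  by elim: k t => [|k IHk] t; rewrite ?addr0// -natr1 addrA f1.
have fint (t : R) : f t = f (t - (Num.floor t)%:~R).
  case: (Num.floor t) => k; first by rewrite -[RHS](fnat k) pmulrn subrK.
  by rewrite NegzE mulrNz opprK fnat.
have cfn : {within `[0, 1], continuous (fun t => `|f t|)}.
  apply: continuous_subspaceT => t.
  by apply: continuous_comp; [exact: cf|exact: norm_continuous].
have [c _ fc] := EVT_max ler01 cfn.
exists `|f c| => t; rewrite fint; apply: fc.
rewrite in_itv /= subr_ge0 ge_floor lerBlDl.
by have := ltW (lt_succ_floor t); rewrite intrD.
Qed.
End RealAnalysis.

(** * Absolutely convergent sums *)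

Section AbsoluteSums.
Variable R : realType.

Lemma nnseries_bounded (u : nat -> R) (B : R) :
  (forall m, 0 <= u m) -> (forall N, series u N <= B) ->
  (\sum_(m <oo) (u m)%:E)%E \is a fin_num /\
  series u @ \oo --> fine (\sum_(m <oo) (u m)%:E)%E.
Proof.
move=> u0 uB.
have cu : cvgn (series u).
  apply: nondecreasing_is_cvgn; first exact: nondecreasing_series.
  by exists B => _ [N _ <-].
have -> : (\sum_(m <oo) (u m)%:E)%E = (limn (series u))%:E.
  rewrite -EFin_lim//; apply/congr_lim/funext => N /=.
  by rewrite sumEFin.
by [].
Qed.

(** Tonelli: both iterated sums are sums over pairs, exchanged by the swap. *)
Lemma esum_nneseries (I : choiceType) (a : nat -> I -> \bar R) :
  (forall m i, (0 <= a m i)%E) ->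
  (\esum_(i in [set: I]) \sum_(m <oo) a m i =
   \sum_(m <oo) \esum_(i in [set: I]) a m i)%E.
Proof.
move=> a0; rewrite nneseries_esumT; last by move=> m; exact: esum_ge0.
rewrite (@eq_esum _ _ _ _ (fun i => \esum_(m in [set: nat]) a m i)%E); last first.
  by move=> i _; rewrite nneseries_esumT.
rewrite esum_esum// esum_esum//.
rewrite (@reindex_esum _ _ _ ([set: nat] `*`` (fun=> [set: I])) _
  (fun k => (k.2, k.1)))//.
split=> //.
- by move=> [m i] [m' i'] _ _ [-> ->].
- by move=> [i m] _; exists (m, i).
Qed.

Section Fibres.
Variables (I : choiceType) (J : choiceType) (s : nat -> seq J) (e : J -> I).

(** In the application [s m] lists the label words of length [m] and [e] is the end vertex, so a sum
    over words is regrouped by vertices. *)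
Let fibre (c : J -> R) (z : I) (m : nat) : R :=
  \sum_(x <- s m) (e x == z)%:R * c x.

(** After the exchange of sums, each [x] contributes [d x] at the single point [e x]. *)
Lemma esum_fibre (d : J -> R) (B : R) : (forall x, 0 <= d x) ->
  (forall N, series (fun m => \sum_(x <- s m) d x) N <= B) ->
  [/\ (\esum_(z in [set: I]) \sum_(m <oo) (fibre d z m)%:E)%E
        = (\sum_(m <oo) (\sum_(x <- s m) d x)%:E)%E,
      (\sum_(m <oo) (\sum_(x <- s m) d x)%:E)%E \is a fin_num &
      forall z, (\sum_(m <oo) (fibre d z m)%:E)%E \is a fin_num /\
        series (fibre d z) @ \oo --> fine (\sum_(m <oo) (fibre d z m)%:E)%E].
Proof.
move=> d0 dB.
have f0 z m : 0 <= fibre d z m by apply: sumr_ge0 => x _; rewrite mulr_ge0.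
split.
- rewrite esum_nneseries; last by move=> m z; rewrite lee_fin f0.
  apply: eq_eseriesr => m _.
  under eq_esum => z _ do rewrite /fibre -sumEFin.
  rewrite esum_sum; last by move=> z x _ _; rewrite lee_fin mulr_ge0.
  rewrite -sumEFin; apply: eq_bigr => x _.
  rewrite (esumID [set e x])//; last by move=> z _; rewrite lee_fin mulr_ge0.
  rewrite !setTI esum_set1 ?lee_fin ?mulr_ge0// eqxx mul1r.
  rewrite esum1 ?adde0// => z /= /eqP; rewrite eq_sym => /negbTE ->.
  by rewrite mul0r.
- apply: (nnseries_bounded _ dB).1 => m; exact: sumr_ge0.
- move=> z; apply: (nnseries_bounded (f0 z) (B := B)) => N.
  rewrite (le_trans _ (dB N))//; apply: ler_sum => m _.
  by apply: ler_sum => x _; case: eqP; rewrite ?mul1r ?mul0r.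
Qed.

(** Fubini for an absolutely convergent family: the nonnegative case is applied to the positive and
    negative parts of [c]. *)
Lemma asum_fibre (c : J -> R) (B : R) (f : I -> R) :
  (forall N, series (fun m => \sum_(x <- s m) `|c x|) N <= B) ->
  (forall z, series (fibre c z) @ \oo --> f z) ->
  summable [set: I] (EFin \o f) /\
  series (fun m => \sum_(x <- s m) c x) @ \oo --> asum f.
Proof.
move=> cB cf.
pose cp x := Num.max (c x) 0; pose cn x := Num.max (- c x) 0.
have cpn x : c x = cp x - cn x.
  rewrite /cp /cn; case: (leP 0 (c x)) => c0.
    by rewrite max_r ?subr0// oppr_le0.
  by rewrite max_l ?sub0r ?opprK// oppr_ge0 ltW.
have p0 x : 0 <= cp x by rewrite le_max lexx orbT.
have n0 x : 0 <= cn x by rewrite le_max lexx orbT.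
have pB N : series (fun m => \sum_(x <- s m) cp x) N <= B.
  rewrite (le_trans _ (cB N))//; apply: ler_sum => m _; apply: ler_sum => x _.
  by rewrite ge_max normr_ge0 ler_norm.
have nB N : series (fun m => \sum_(x <- s m) cn x) N <= B.
  rewrite (le_trans _ (cB N))//; apply: ler_sum => m _; apply: ler_sum => x _.
  by rewrite ge_max normr_ge0 -normrN ler_norm.
have [Ep Fp Gp] := esum_fibre p0 pB.
have [En Fn Gn] := esum_fibre n0 nB.
set gp := fun z => (\sum_(m <oo) (fibre cp z m)%:E)%E in Ep Gp.
set gn := fun z => (\sum_(m <oo) (fibre cn z m)%:E)%E in En Gn.
have fg : EFin \o f = (gp \- gn)%E.
  apply/funext => z /=.
  have fp : gp z \is a fin_num := (Gp z).1.
  have fn : gn z \is a fin_num := (Gn z).1.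
  rewrite -(fineK fp) -(fineK fn) -EFinB; congr EFin.
  apply: (cvg_unique _ (cf z)) => //.
  rewrite (_ : series _ = series (fibre cp z) - series (fibre cn z)).
    by apply: cvgB; [exact: (Gp z).2|exact: (Gn z).2].
  apply/funext => N; rewrite /series /= -[RHS]sumrB; apply: eq_bigr => m _.
  by rewrite -sumrB; apply: eq_bigr => x _; rewrite cpn mulrBr.
have gp0 z : (0 <= gp z)%E.
  apply: nneseries_ge0 => m _ _; rewrite lee_fin.
  by apply: sumr_ge0 => x _; rewrite mulr_ge0.
have gn0 z : (0 <= gn z)%E.
  apply: nneseries_ge0 => m _ _; rewrite lee_fin.
  by apply: sumr_ge0 => x _; rewrite mulr_ge0.
have sp : summable [set: I] gp.
  rewrite /summable (@eq_esum _ _ _ _ gp) => [|z _]; last by rewrite gee0_abs.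
  by rewrite -/gp Ep ltey_eq Fp.
have sn : summable [set: I] gn.
  rewrite /summable (@eq_esum _ _ _ _ gn) => [|z _]; last by rewrite gee0_abs.
  by rewrite -/gn En ltey_eq Fn.
have sf : summable [set: I] (EFin \o f) by rewrite fg; exact: summableB.
split=> //.
have finp : (\esum_(i in [set: I]) ((EFin \o f)^\+ i)%E)%E \is a fin_num.
  have := summable_funepos sf; rewrite summableE; congr (_ \is a _).
  by apply: eq_esum => z _; rewrite gee0_abs.
have finn : (\esum_(i in [set: I]) ((EFin \o f)^\- i)%E)%E \is a fin_num.
  have := summable_funeneg sf; rewrite summableE; congr (_ \is a _).
  by apply: eq_esum => z _; rewrite gee0_abs.
(* The positive and negative parts of [f] may differ from [gp] and [gn], because of cancellation
   within a fibre; [esumB] shows that the differences of the sums agree. *)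
rewrite /asum -fineB// fg esumB// Ep En fineB//.
rewrite (_ : series _ = series (fun m => \sum_(x <- s m) cp x)
    - series (fun m => \sum_(x <- s m) cn x)); last first.
  apply/funext => N; rewrite /series /= -[RHS]sumrB; apply: eq_bigr => m _.
  by rewrite -sumrB; apply: eq_bigr => x _; rewrite cpn.
by apply: cvgB; [apply: (nnseries_bounded _ pB).2|apply: (nnseries_bounded _ nB).2];
  move=> m; exact: sumr_ge0.
Qed.

End Fibres.

Lemma asum_finite (I : choiceType) (J : choiceType) (s : seq J) (e : J -> I)
    (c : J -> R) :
  asum (fun z => \sum_(x <- s) (e x == z)%:R * c x) = \sum_(x <- s) c x.
Proof.
(* The finite sum is placed in block 0, so the partial sums are constant from index 1 on. *)
pose s' m := if m is 0%N then s else [::].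
have ser (d : J -> R) N :
    series (fun m => \sum_(x <- s' m) d x) N.+1 = \sum_(x <- s) d x.
  rewrite /series /= big_nat_recl//= [X in _ + X]big1 ?addr0// => m _.
  by rewrite big_nil.
have lim (d : J -> R) : series (fun m => \sum_(x <- s' m) d x) @ \oo -->
    \sum_(x <- s) d x.
  by apply: cvg_near_cst; exists 1%N => // -[|N] _ //=; rewrite -(ser d N).
have [|_] := @asum_fibre I J s' e c (\sum_(x <- s) `|c x|) _ _
    (fun z => lim (fun x => (e x == z)%:R * c x)).
  move=> [|N]; last by rewrite ser.
  by rewrite /series /= big_geq// sumr_ge0.
by move/(cvg_unique _ (lim c)) => <-.
Qed.

End AbsoluteSums.

(** * Paths in the cycle-incidence graph *)

Section Paths.
Variables (R : realType) (n : nat) (X : finCW R n.+1).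
Variables (C : cellular_complex X) (S : signed_sets C) (z0 : chains X n int).
Local Notation label := (label S).
Local Notation edge := (edge S).
Local Notation vertex := (Gamma0 S z0).
Implicit Types (l : label) (e : edge) (z : chains X n int).

Definition usable l z : bool :=
  (z (tag l).2 != 0) && (incidence C (tag l).1 (tag l).2 != 0).

Lemma directed_path_cat z (es es' : seq edge) :
  directed_path z0 z (es ++ es') <->
  directed_path z0 z es /\ directed_path z0 (last z [seq target e | e <- es]) es'.
Proof.
elim: es z => [|e es IHes] z /=; first by split=> [|[]].
by split=> [[? ? /IHes[]]|[[? ? ?] ?]]; split=> //; apply/IHes.
Qed.

Lemma directed_path_graph_edge z (es : seq edge) e :
  directed_path z0 z es -> e \in es -> graph_edge z0 e.
Proof.
elim: es z => // e' es IHes z [ge' _ es_path].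
by rewrite inE => /predU1P[->//|]; exact: IHes es_path.
Qed.

(** A path through [z] can be cut right after the edge that reaches it. *)
Lemma Gamma0P z : vertex z <->
  exists2 es : seq edge, directed_path z0 z0 es
    & last z0 [seq target e | e <- es] = z.
Proof.
split=> [[es es_path]|[es es_path <-]]; last by exists es => //; exact: mem_last.
rewrite inE => /predU1P[->|]; first by exists [::].
move=> /mapP[e e_es ->]; move: es_path; case/path.splitP: e_es => p1 p2.
rewrite directed_path_cat => -[p1_path _]; exists (rcons p1 e) => //.
by rewrite map_rcons last_rcons.
Qed.

Lemma ffunMzE (T : finType) (V : zmodType) (g : {ffun T -> V}) (k : int) x :
  (g *~ k) x = g x *~ k.
Proof.
case: k => k; first by rewrite -!pmulrn ffunMnE.
by rewrite NegzE !mulrNz -!pmulrn ffunE ffunMnE.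
Qed.

Lemma targetE l z j : target (S := S) (l, z) j =
  z j - incidence C (tag l).1 j * ((-1) ^+ chi S (tagged l) * z (tag l).2).
Proof. by rewrite /target !ffunE ffunMzE ffunE mulrzz. Qed.

Lemma graph_vertex_target e : graph_edge z0 e -> graph_vertex C z0 (target e).
Proof.
move=> [[b [c _ bc] zb] _ _]; rewrite /target zb -addrA.
set a := edge_alpha e; set k := _ * _; exists (b - bdry_cell C a *~ k) => //.
exists (c - [ffun b => (b == a)%:R] *~ k) => //.
rewrite -bdry_delta -bc; apply/ffunP => j; rewrite !(ffunE, ffunMzE).
rewrite mulrz_suml -sumrB; apply: eq_bigr => a' _.
by rewrite !(ffunE, ffunMzE) mulrBl mulrzAl.
Qed.

Lemma Gamma0_graph_vertex z : vertex z -> graph_vertex C z0 z.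
Proof.
case=> es es_path; rewrite inE => /predU1P[->|/mapP[e e_es ->]].
  exists 0; last by rewrite addr0.
  exists 0 => //; apply/ffunP => j; rewrite !ffunE big1// => a _.
  by rewrite ffunE mul0r.
exact/graph_vertex_target/(directed_path_graph_edge es_path).
Qed.

Lemma usableP l z : vertex z -> reflect (graph_edge z0 (l, z)) (usable l z).
Proof.
by move=> /Gamma0_graph_vertex vz; apply: (iffP andP) => [[]|[]].
Qed.

Lemma path_rcons z l (es : seq edge) : directed_path z0 z0 es ->
  last z0 [seq target e | e <- es] = z -> usable l z ->
  directed_path z0 z0 (rcons es (l, z)).
Proof.
move=> es_path es_z zl; rewrite -cats1 directed_path_cat es_z /=; split=> //.
split=> //; apply/usableP => //; apply/Gamma0P; by exists es.
Qed.

(** A path that reaches [w] can be prolonged by any edge of the ambient graph leaving [w], so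
    membership in [Gamma1] becomes a decidable condition on the label. *)
Lemma Gamma1_usable (w : vertex) l : ((l, val w) \in Gamma1 (S := S) z0) = usable l (val w).
Proof.
have vw : vertex (val w) by have := valP w; rewrite inE.
apply/idP/idP; rewrite inE.
  by case=> es es_path /(directed_path_graph_edge es_path)/(usableP _ vw).
move=> lw; have [es es_path es_w] := (Gamma0P _).1 vw.
exists (rcons es (l, val w)); first exact: path_rcons.
by rewrite mem_rcons mem_head.
Qed.

Lemma vertex_target (w : vertex) l : usable l (val w) ->
  target (S := S) (l, val w) \in vertex.
Proof.
move=> lw; have vw : vertex (val w) by have := valP w; rewrite inE.
have [es es_path es_w] := (Gamma0P _).1 vw.
rewrite inE; apply/Gamma0P; exists (rcons es (l, val w)); first exact: path_rcons.
by rewrite map_rcons last_rcons.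
Qed.

(** The graph has no loops: the coordinate of the cell f changes by plus or minus the nonzero
    product of the incidence number and that coordinate. *)
Lemma target_neq l z : usable l z -> target (S := S) (l, z) != z.
Proof.
case/andP=> zf bf; apply/eqP => /ffunP/(_ (tag l).2)/eqP.
rewrite targetE -subr_eq0 addrC addKr oppr_eq0 !mulf_eq0 (negbTE bf) (negbTE zf).
by rewrite signr_eq0.
Qed.

Definition root_vertex : vertex.
Proof.
by exists z0; rewrite inE; exists [::]; rewrite ?mem_head.
Defined.

(* Labels that give no edge out of [w] stay at [w]. *)
Definition step l (w : vertex) : vertex :=
  insubd w (if usable l (val w) then target (S := S) (l, val w) else val w).

Lemma val_step l (w : vertex) : val (step l w) =
  if usable l (val w) then target (S := S) (l, val w) else val w.
Proof.
rewrite /step; case: ifPn => lw; rewrite val_insubd; first by rewrite vertex_target.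
by rewrite if_same.
Qed.

(* The labels of a path are listed from the last edge to the first. *)
Definition endpoint (ls : seq label) : vertex := foldr step root_vertex ls.

(** All words are listed, even those with labels that give no edge; [flow] vanishes on such labels,
    hence so does the weight of the word. *)
Fixpoint paths (m : nat) : seq (seq label) :=
  if m is m'.+1 then [seq l :: ls | ls <- paths m', l <- enum {: label}]
  else [:: [::]].

Lemma sum_pathsS (V : nmodType) m (F : seq label -> V) :
  \sum_(ls <- paths m.+1) F ls = \sum_(ls <- paths m) \sum_l F (l :: ls).
Proof. by rewrite /= big_allpairs_dep; apply: eq_bigr => ls _; rewrite big_enum. Qed.

Lemma sum_paths_const (V : pzRingType) m (c : nat -> V) :
  \sum_(ls <- paths m) c (size ls) = #|{: label}|%:R ^+ m * c m.
Proof.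
elim: m c => [|m IHm] c; first by rewrite big_seq1 mul1r.
rewrite sum_pathsS exprS -mulrA mulr_natl -sumr_const.
under eq_bigr do rewrite /= sumr_const.
by rewrite (IHm (fun k => c k.+1 *+ #|{: label}|)) sumr_const mulrnAr.
Qed.

(** A step changes any coordinate by at most [c] times another coordinate of the same vertex, so a
    common bound on all coordinates grows by at most the factor 1 + c. *)
Lemma endpoint_le : exists V L : R, [/\ 1 <= V, 1 <= L &
  forall ls j, `|(val (endpoint ls) j)%:~R : R| <= V * L ^+ size ls].
Proof.
pose c : R := \sum_(a : cell X n.+1) \sum_(j : cell X n) `|(incidence C a j)%:~R|.
have c_ge (a : cell X n.+1) (j : cell X n) : `|(incidence C a j)%:~R : R| <= c.
  rewrite /c (bigD1 a)//= (bigD1 j)//= -addrA lerDl addr_ge0 ?sumr_ge0//.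
  by move=> a' _; exact: sumr_ge0.
have c0 : 0 <= c by apply: sumr_ge0 => a _; exact: sumr_ge0.
pose V : R := 1 + \sum_j `|(z0 j)%:~R|.
have V1 : 1 <= V by rewrite lerDl sumr_ge0.
exists V, (1 + c); split=> //; first by rewrite lerDl.
elim=> [|l ls IHls] j /=.
  by rewrite mulr1 /V (bigD1 j)//= addrCA lerDl addr_ge0 ?ler01 ?sumr_ge0.
have VL : 0 <= V * (1 + c) ^+ size ls.
  apply: mulr_ge0; first exact: le_trans ler01 V1.
  exact/exprn_ge0/addr_ge0.
rewrite val_step exprSr mulrA mulrDr mulr1; case: ifPn => _; last first.
  by rewrite (le_trans (IHls j))// lerDl mulr_ge0.
rewrite targetE rmorphB /= (le_trans (ler_normB _ _))// lerD//.
rewrite !rmorphM /= rmorphXn /= rmorphN1 normrM normrMsign mulrC.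
exact: ler_pM.
Qed.

End Paths.

(** * Path weights *)

Section Weights.
Variables (R : realType) (n : nat) (X : finCW R n.+1).
Variables (C : cellular_complex X) (S : signed_sets C) (z0 : chains X n int).
Variables (beta : R) (D : driving_protocol X).
Local Notation label := (label S).
Local Notation vertex := (Gamma0 S z0).
Implicit Types (l : label) (ls : seq label) (w z : vertex) (t : R).

Definition jump_rate t (a : cell X n.+1) (f : cell X n) : R :=
  expR (beta * ((protocol D t).1 f - (protocol D t).2 a)).

Definition flow t l w : R :=
  tauD D * jump_rate t (tag l).1 (tag l).2 *+ usable l (val w).

Definition outflow t w : R := \sum_l flow t l w.

(** A solution is selected by choice; the default [cst 0] is never reached for continuous
    coefficients. *)
Definition ode_solution (a g : R -> R) (c : R) : R -> R :=
  xget (cst 0) [set p | p 0 = c /\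
    forall t, is_derive t (1 : R) p (a t * p t + g t)].

(** Iterated Duhamel formula: the weight of a path decays at the total exit rate of its end vertex
    and is fed by the path without its last edge. *)
Fixpoint weight ls : R -> R :=
  if ls is l :: ls' then
    ode_solution (fun t => - outflow t (endpoint z0 ls))
      (fun t => flow t l (endpoint z0 ls') * weight ls' t) 0
  else ode_solution (fun t => - outflow t (root_vertex S z0)) (cst 0) 1.

Lemma ode_solutionP a g c : continuous a -> continuous g ->
  ode_solution a g c 0 = c /\
  forall t, is_derive t (1 : R) (ode_solution a g c)
    (a t * ode_solution a g c t + g t).
Proof.
move=> ca cg; have [p [p0 dp]] := linear_ode_exists c ca cg.
rewrite /ode_solution; case: xgetP => [q _ //|/(_ p)] /=; by case.
Qed.

Lemma derivable_protocol t :
  (forall j, derivable (fun s => (protocol D s).1 j) t 1) /\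
  (forall a, derivable (fun s => (protocol D s).2 a) t 1).
Proof.
by have [E W] := protocol_smooth D; split=> [j|a]; [exact: (E j 0%N)|exact: (W a 0%N)].
Qed.

Lemma jump_rate_continuous a f : continuous (fun t => jump_rate t a f).
Proof.
have dE t := derivableP ((derivable_protocol t).1 f).
have dW t := derivableP ((derivable_protocol t).2 a).
have dEW t := is_derive1_sub (dE t) (dW t).
have db t := is_derive1_mul (is_derive_cst beta t 1) (dEW t).
exact: (is_derive1_continuous (fun t => is_derive1_expRM (db t))).
Qed.

Lemma flow_continuous l w : continuous (fun t => flow t l w).
Proof.
rewrite /flow; case: usable; last by move=> t; exact: cvg_cst.
by move=> t; apply: cvgMr; exact: jump_rate_continuous.
Qed.

Lemma outflow_continuous w : continuous (fun t => - outflow t w).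
Proof.
move=> t; apply: cvgN; apply: cvg_big => [|l _]; first exact: add_continuous.
exact: flow_continuous.
Qed.

Lemma jump_rate_bounded : exists2 B : R, 0 < B & forall t a f, jump_rate t a f <= B.
Proof.
have per a f : exists K, forall t, `|jump_rate t a f| <= K.
  apply: periodic_bounded; first exact: jump_rate_continuous.
  by move=> t; rewrite /jump_rate protocol_periodic.
have [K HK] := choice (fun af => per af.1 af.2).
exists (1 + \sum_af `|K af|) => [|t a f].
  by rewrite (lt_le_trans ltr01)// lerDl sumr_ge0.
rewrite (le_trans (ler_norm _))// (le_trans (HK (a, f) t))//.
rewrite (le_trans (ler_norm _))// (bigD1 (a, f))//= addrCA lerDl.
by rewrite addr_ge0 ?ler01 ?sumr_ge0.
Qed.

Lemma weight_continuous ls : continuous (weight ls).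
Proof.
elim: ls => [|l ls IHls] /=.
  have [_ dp] := ode_solutionP 1 (@outflow_continuous (root_vertex S z0))
    (@cst_continuous _ _ 0).
  exact: is_derive1_continuous dp.
have cg : continuous (fun t => flow t l (endpoint z0 ls) * weight ls t).
  by move=> t; apply: cvgM; [exact: flow_continuous|exact: IHls].
have [_ dp] := ode_solutionP 0 (@outflow_continuous (endpoint z0 (l :: ls))) cg.
exact: is_derive1_continuous dp.
Qed.

Lemma weight_nil : weight [::] 0 = 1 /\
  forall t, is_derive t (1 : R) (weight [::])
    (- outflow t (endpoint z0 [::]) * weight [::] t).
Proof.
have [p0 dp] := ode_solutionP 1 (@outflow_continuous (root_vertex S z0))
  (@cst_continuous _ _ 0).
by split=> // t; apply: (is_derive_eq (dp t)); rewrite addr0.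
Qed.

Lemma weight_cons l ls : weight (l :: ls) 0 = 0 /\
  forall t, is_derive t (1 : R) (weight (l :: ls))
    (- outflow t (endpoint z0 (l :: ls)) * weight (l :: ls) t
     + flow t l (endpoint z0 ls) * weight ls t).
Proof.
apply: ode_solutionP; first exact: outflow_continuous.
by move=> t; apply: cvgM; [exact: flow_continuous|exact: weight_continuous].
Qed.

Lemma flow_ge0 t l w : 0 <= flow t l w.
Proof. by rewrite mulrn_wge0// mulr_ge0 ?expR_ge0// ltW// tauD_gt0. Qed.

(** The bound is uniform over the possibly infinite vertex set, since a rate depends only on the
    time and on one of finitely many labels. *)
Lemma outflow_bounded : exists2 K : R, 0 < K & forall t w, outflow t w <= K.
Proof.
have [B B0 HB] := jump_rate_bounded.
have tB : 0 <= tauD D * B by rewrite mulr_ge0 ?ltW ?tauD_gt0.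
exists (1 + tauD D * B *+ #|{: label}|); first by rewrite ltr_pwDl// mulrn_wge0.
move=> t w; rewrite (@le_trans _ _ (tauD D * B *+ #|{: label}|)) ?lerDr//.
rewrite -sumr_const; apply: ler_sum => l _; rewrite /flow.
by case: usable => //; rewrite mulr1n ler_pM2l ?tauD_gt0.
Qed.

Lemma flow_le_outflow t l w : flow t l w <= outflow t w.
Proof.
by rewrite /outflow (bigD1 l)//= lerDl sumr_ge0// => l' _; exact: flow_ge0.
Qed.

(* The exponential rate is chosen so large that adding an edge to a path costs
   the arbitrarily small factor [th]. *)
Lemma weight_le th : 0 < th -> exists l : R,
  forall ls t, `|weight ls t| <= th ^+ size ls * expR (l * `|t|).
Proof.
move=> th0; have [K K0 HK] := outflow_bounded; exists (K + K / th).
have KK : 0 <= K <= K + K / th by rewrite ltW//= lerDl divr_ge0// ltW.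
have oK t w : `|- outflow t w| <= K.
  by rewrite normrN ger0_norm// sumr_ge0// => l _; exact: flow_ge0.
elim=> [|l ls IHls] t.
  have [p0 dp] := weight_nil.
  apply: (gronwall_exp dp KK); rewrite ?expr0 ?ler01 ?p0 ?normr1// => s.
  rewrite normrM ler_wpDr ?ler_wpM2r ?oK// !mulr_ge0 ?expR_ge0//.
  by rewrite addrC addKr divr_ge0 ?ltW.
have [p0 dp] := weight_cons l ls; have thn k : 0 <= th ^+ k by rewrite exprn_ge0 ?ltW.
apply: (gronwall_exp dp KK); rewrite ?p0 ?normr0 ?thn// => s.
rewrite (le_trans (ler_normD _ _))// lerD//; first by rewrite normrM ler_wpM2r ?oK.
rewrite normrM (ger0_norm (flow_ge0 _ _ _)).
rewrite (@le_trans _ _ (K * (th ^+ size ls * expR ((K + K / th) * `|s|))))//.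
  by rewrite ler_pM ?flow_ge0// (le_trans (flow_le_outflow _ _ _)).
(* Equality holds, since the gap between the exponential rate and [K] is K/th and th^(m+1) K/th = K
   th^m. *)
rewrite le_eqVlt; apply/predU1P; left; rewrite /= exprS.
by field; rewrite gt_eqF.
Qed.

Lemma sum_weight_le (V L : R) : 1 <= V -> 1 <= L -> exists l : R,
  forall (h : seq label -> R), (forall ls, `|h ls| <= V * L ^+ size ls) ->
  forall m t, \sum_(ls <- paths S m) `|weight ls t * h ls|
    <= V * expR (l * `|t|) * 2^-1 ^+ m.
Proof.
(* The added 1 keeps [N] invertible when there are no labels. The rate [l] is fixed before [h], so
   that it serves all observables at once. *)
move=> V1 L1; pose N : R := #|{: label}|%:R + 1.
have N0 : 0 < N by rewrite ltr_wpDl.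
have L0 : 0 < L by exact: lt_le_trans L1.
have V0 : 0 < V by exact: lt_le_trans V1.
have th0 : 0 < (2 * N * L)^-1 by rewrite invr_gt0 !mulr_gt0.
have [l Hl] := weight_le th0; exists l => h hV m t.
pose b k : R := (2 * N * L)^-1 ^+ k * expR (l * `|t|) * (V * L ^+ k).
rewrite (@le_trans _ _ (\sum_(ls <- paths S m) b (size ls)))//.
  by apply: ler_sum => ls _; rewrite normrM ler_pM.
rewrite sum_paths_const /b.
rewrite (@le_trans _ _ (N ^+ m * b m))//.
  rewrite ler_wpM2r ?lerXn2r ?nnegrE ?lerDl ?(ltW N0)//.
  by rewrite !mulr_ge0 ?exprn_ge0 ?expR_ge0 ?ltW.
rewrite le_eqVlt /b; apply/predU1P; left.
rewrite [X in _ = _ * X](_ : _ = N ^+ m * (2 * N * L)^-1 ^+ m * L ^+ m); first by ring.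
rewrite -!exprMn; congr (_ ^+ _); field.
by rewrite !gt_eqF.
Qed.

End Weights.

(** * Expectation of the path expansion *)

Section GeometricBound.
Variable R : realType.

(** The sum telescopes, as c 2^(-k) = 2c 2^(-k) - 2c 2^(-k-1). *)
Lemma geometric_partial (c : R) N M : 0 <= c ->
  \sum_(N <= k < M) c * 2^-1 ^+ k <= 2 * c * 2^-1 ^+ N.
Proof.
move=> c0; have c2 k : 0 <= 2 * c * 2^-1 ^+ k :> R.
  by rewrite !mulr_ge0 ?exprn_ge0.
have [NM|/ltnW MN] := leqP N M; last by rewrite big_geq.
have E : \sum_(N <= k < M) (2 * c * 2^-1 ^+ k.+1 - 2 * c * 2^-1 ^+ k) =
    2 * c * 2^-1 ^+ M - 2 * c * 2^-1 ^+ N by rewrite telescope_sumr.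
rewrite (_ : \sum_(N <= k < M) _ = 2 * c * 2^-1 ^+ N - 2 * c * 2^-1 ^+ M).
  by rewrite gerBl.
apply: oppr_inj; rewrite opprB -E -sumrN; apply: eq_bigr => k _.
rewrite exprS; lra.
Qed.

Lemma geometric_series_cvg (u : nat -> R) (c : R) :
  (forall m, `|u m| <= c * 2^-1 ^+ m) -> cvgn (series u).
Proof.
move=> uc; apply: normed_cvg; apply: (series_le_cvg _ _ uc).
- by move=> m; exact: normr_ge0.
- by move=> m; exact: le_trans (uc m).
- by apply: is_cvg_geometric_series; rewrite ger0_norm ?invf_lt1 ?ltr1n.
Qed.

Lemma geometric_series_tail (u : nat -> R) (c l : R) :
  (forall m, `|u m| <= c * 2^-1 ^+ m) -> series u @ \oo --> l ->
  forall N, `|l - series u N| <= 2 * c * 2^-1 ^+ N.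
Proof.
move=> uc ul N.
have c0 : 0 <= c by have := le_trans (normr_ge0 _) (uc 0%N); rewrite expr0 mulr1.
apply: (@cvg_norm_le _ (fun M => series u M - series u N)).
  by apply: cvgB; [exact: ul|exact: cvg_cst].
exists N => // M /= NM; rewrite sub_series_geq//.
rewrite (le_trans (ler_norm_sum _ _ _))//.
rewrite (le_trans _ (geometric_partial N M c0))//.
by apply: ler_sum => k _.
Qed.

End GeometricBound.

Section Expansion.
Variables (R : realType) (n : nat) (X : finCW R n.+1).
Variables (C : cellular_complex X) (S : signed_sets C) (z0 : chains X n int).
Variables (beta : R) (D : driving_protocol X).
Local Notation label := (label S).
Local Notation vertex := (Gamma0 S z0).
Local Notation endpoint := (@endpoint R n X C S z0).
Local Notation flow := (@flow R n X C S z0 beta D).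
Local Notation outflow := (@outflow R n X C S z0 beta D).
Local Notation weight := (@weight R n X C S z0 beta D).
Implicit Types (l : label) (ls : seq label) (w z : vertex) (t : R).

(** The observable [h] will be either the indicator of an end vertex, which gives the perturbation
    coefficient, or a coordinate of the end vertex, which gives its first moment. *)
Definition path_sum (h : seq label -> R) m t : R :=
  \sum_(ls <- paths S m) h ls * weight ls t.

Definition at_vertex z ls : R := (endpoint ls == z)%:R.

Definition order_part m t : vertex_distribution S z0 :=
  fun z => path_sum (at_vertex z) m t.

(** * The perturbation series as a sum over paths *)

Lemma Acoef_diag t z : Acoef beta D t z z = - outflow t z.
Proof.
rewrite /Acoef /master_coef /outflow mulNr mulr_sumr; congr (- _).
rewrite big_mkcond; apply: eq_bigr => l _; rewrite Gamma1_usable /flow.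
case: ifPn => // lz; rewrite eqxx eq_sym (negbTE (target_neq lz)) subr0 mulr1.
by rewrite mulr1n.
Qed.

Lemma A0coefE t p z : apply_op (A0coef beta D t) p z = - outflow t z * p z.
Proof.
rewrite /apply_op -(Acoef_diag t z).
have E := asum_finite [:: z] id (fun w => Acoef beta D t w w * p w).
rewrite big_seq1 in E; rewrite -E; congr asum.
apply/funext => w; rewrite big_seq1 /A0coef.
by case: eqP => [->|_]; rewrite ?mul1r ?mul0r.
Qed.

Lemma A1coefE t z w :
  A1coef beta D t z w = \sum_l flow t l w * (step l w == z)%:R.
Proof.
have vE l : usable l (val w) -> (val z == target (S := S) (l, val w)) = (step l w == z).
  by move=> lw; rewrite -val_eqE val_step lw eq_sym.
rewrite /A1coef; case: eqVneq => [zw|zw].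
  subst z.
  rewrite big1// => l _; rewrite /flow; case lw: usable; last by rewrite mul0r.
  by rewrite -vE// eq_sym (negbTE (target_neq lw)) mulr0.
rewrite /Acoef /master_coef mulNr mulr_sumr -sumrN big_mkcond.
apply: eq_bigr => l _; rewrite Gamma1_usable /flow.
case: ifPn => lw; last by rewrite mul0r.
by rewrite val_eqE (negbTE zw) sub0r vE// mulr1n !mulrN opprK mulrA.
Qed.

(** The distribution is carried by finitely many end vertices, so the sum over the graph is finite
    and the off-diagonal operator prolongs each word by one label. *)
Lemma A1coef_path_sum t (c : seq label -> R) (s : seq (seq label)) z :
  apply_op (A1coef beta D t) (fun w => \sum_(ls <- s) at_vertex w ls * c ls) z =
  \sum_(ls <- s) \sum_l at_vertex z (l :: ls) * (flow t l (endpoint ls) * c ls).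
Proof.
rewrite /apply_op.
have := asum_finite s endpoint (fun ls => A1coef beta D t z (endpoint ls) * c ls).
rewrite (_ : (fun _ => _) = fun w =>
  A1coef beta D t z w * \sum_(ls <- s) at_vertex w ls * c ls); last first.
  apply/funext => w; rewrite mulr_sumr; apply: eq_bigr => ls _.
  by rewrite /at_vertex; case: eqP => [->|_]; rewrite ?mul1r// !mul0r mulr0.
move=> ->; apply: eq_bigr => ls _; rewrite A1coefE mulr_suml.
by apply: eq_bigr => l _; rewrite /at_vertex /=; ring.
Qed.

Lemma path_sum0_derive (h : seq label -> R) t :
  is_derive t (1 : R) (path_sum h 0)
    (h [::] * (- outflow t (endpoint [::]) * weight [::] t)).
Proof.
have [_ dp] := weight_nil S z0 beta D.
rewrite (_ : path_sum h 0 = fun s => h [::] * weight [::] s).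
  apply: (is_derive_eq (is_derive1_mul (is_derive_cst (h [::]) t 1) (dp t))).
  by rewrite mulr0 addr0.
by apply/funext => s; rewrite /path_sum big_seq1.
Qed.

Lemma path_sumS_derive (h : seq label -> R) m t :
  is_derive t (1 : R) (path_sum h m.+1)
    (\sum_(ls <- paths S m.+1) h ls * (- outflow t (endpoint ls) * weight ls t) +
     \sum_(ls <- paths S m) \sum_l h (l :: ls) *
       (flow t l (endpoint ls) * weight ls t)).
Proof.
rewrite (_ : path_sum h m.+1 = fun s =>
  \sum_(ls <- paths S m) \sum_l h (l :: ls) * weight (l :: ls) s).
  rewrite sum_pathsS -big_split /=.
  apply: is_derive1_sum => ls; rewrite -big_split /=.
  apply: is_derive1_sum => l; have [_ dp] := weight_cons z0 beta D l ls.
  apply: (is_derive_eq (is_derive1_mul (is_derive_cst (h (l :: ls)) t 1) (dp t))).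
  by rewrite mulr0 addr0 -mulrDr.
by apply/funext => s; rewrite /path_sum sum_pathsS.
Qed.

Lemma order_part_series : perturbation_series beta D order_part.
Proof.
split=> [[|m] z|[|m] t z].
- rewrite /order_part /path_sum big_seq1 (weight_nil S z0 beta D).1 mulr1.
  by rewrite /at_vertex /initial_distribution -val_eqE eq_sym.
- rewrite /order_part /path_sum sum_pathsS big1// => ls _; rewrite big1// => l _.
  by rewrite (weight_cons z0 beta D l ls).1 mulr0.
- apply: (is_derive_eq (path_sum0_derive (at_vertex z) t)).
  rewrite A0coefE addr0 /order_part /path_sum big_seq1 /at_vertex.
  by case: eqP => [<-|_]; rewrite ?mul1r// !mul0r mulr0.
apply: (is_derive_eq (path_sumS_derive (at_vertex z) m t)).
rewrite A0coefE A1coef_path_sum; congr (_ + _).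
rewrite /order_part /path_sum mulr_sumr; apply: eq_bigr => ls _.
by rewrite /at_vertex; case: eqP => [<-|_]; rewrite ?mul1r// !mul0r mulr0.
Qed.

(** By induction on the order: once the previous coefficients agree, the forcing terms cancel and
    the difference solves a homogeneous scalar equation at each vertex. *)
Lemma perturbation_series_uniq (p p' : nat -> R -> vertex_distribution S z0) :
  perturbation_series beta D p -> perturbation_series beta D p' -> p = p'.
Proof.
move=> [p0 dp] [p'0 dp']; have [K _ HK] := outflow_bounded S z0 beta D.
have uniq_zero z (f : R -> R) : f 0 = 0 ->
    (forall t, is_derive t (1 : R) f (- outflow t z * f t)) -> forall t, f t = 0.
  move=> f0 df t; apply: (@linear_system_uniq R unit (fun s _ _ => - outflow s z) K
    (fun s _ => f s)) => // [s _ _|s _].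
    rewrite normrN ger0_norm// sumr_ge0// => l _; exact: flow_ge0.
  by apply: (is_derive_eq (df s)); rewrite big_const card_unit /= addr0.
suff pp' m : p m = p' m by apply/funext.
elim: m => [|m IHm]; apply/funext => t; apply/funext => z; apply/eqP;
    rewrite -subr_eq0; apply/eqP.
  apply: (uniq_zero z (fun s => p 0%N s z - p' 0%N s z)) => [|s].
    by rewrite p0 p'0 subrr.
  apply: (is_derive_eq (is_derive1_sub (dp 0%N s z) (dp' 0%N s z))).
  by rewrite !A0coefE !addr0 -mulrBr.
apply: (uniq_zero z (fun s => p m.+1 s z - p' m.+1 s z)) => [|s].
  by rewrite p0 p'0 subrr.
apply: (is_derive_eq (is_derive1_sub (dp m.+1 s z) (dp' m.+1 s z))).
by rewrite !A0coefE IHm opprD addrACA subrr addr0 -mulrBr.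
Qed.

(** * Convergence of the expansion and of its first moment *)

Definition coord (j : cell X n) ls : R := (val (endpoint ls) j)%:~R.

Lemma path_sums_dominated : exists V lam : R, 0 <= V /\ forall m t,
  (forall z, \sum_(ls <- paths S m) `|at_vertex z ls * weight ls t|
     <= V * expR (lam * `|t|) * 2^-1 ^+ m) /\
  (forall j, \sum_(ls <- paths S m) `|coord j ls * weight ls t|
     <= V * expR (lam * `|t|) * 2^-1 ^+ m).
Proof.
have [V [L [V1 L1 HVL]]] := endpoint_le S z0.
have [lam Hlam] := @sum_weight_le R n X C S z0 beta D V L V1 L1.
exists V, lam; split; first exact: le_trans ler01 V1.
move=> m t; split=> [z|j]; under eq_bigr => ls _ do rewrite mulrC.
  apply: Hlam => ls; rewrite /at_vertex.
  apply: (@le_trans _ _ 1); first by case: eqP => _; rewrite ?normr1 ?normr0.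
  by rewrite -[1]mulr1 ler_pM// exprn_ege1.
by apply: Hlam => ls; exact: HVL.
Qed.

Lemma order_part_cvg t z : cvgn (series (fun m => order_part m t z)).
Proof.
have [V [lam [_ HV]]] := path_sums_dominated.
apply: (@geometric_series_cvg _ _ (V * expR (lam * `|t|))) => m.
exact: le_trans (ler_norm_sum _ _ _) ((HV m t).1 z).
Qed.

Definition path_solution t : vertex_distribution S z0 :=
  fun z => limn (series (fun m => order_part m t z)).

Lemma path_solution_unique : unique (formal_solution beta D) path_solution.
Proof.
split.
  by exists order_part; [exact: order_part_series|move=> t z; exact: order_part_cvg].
move=> rho' [p /perturbation_series_uniq/(_ order_part_series) -> p_cvg].
apply/funext => t; apply/funext => z.
by apply: (cvg_unique _ _ (p_cvg t z)) => //; exact: order_part_cvg.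
Qed.

Lemma path_solution_expectation t :
  expectation_summable (path_solution t) /\
  forall j, series (fun m => path_sum (coord j) m t) @ \oo -->
    vertex_expectation (path_solution t) j.
Proof.
have [V [lam [V0 HV]]] := path_sums_dominated.
pose c0 := V * expR (lam * `|t|).
have c00 : 0 <= c0 by rewrite mulr_ge0 ?expR_ge0.
suff H j : summable [set: vertex]
      (EFin \o (fun z : vertex => path_solution t z * (val z j)%:~R)) /\
    series (fun m => path_sum (coord j) m t) @ \oo -->
    asum (fun z : vertex => path_solution t z * (val z j)%:~R).
  by split=> j; [exact: (H j).1|rewrite ffunE; exact: (H j).2].
apply: (@asum_fibre R vertex (seq label) (paths S) endpoint
  (fun ls => coord j ls * weight ls t) (2 * c0 * 2^-1 ^+ 0)).
  move=> N; apply: le_trans (geometric_partial 0 N c00).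
  by apply: ler_sum => m _; exact: (HV m t).2.
move=> z; rewrite (_ : series _ = fun N =>
    series (fun m => order_part m t z) N * (val z j)%:~R).
  by apply: cvgMl; exact: order_part_cvg.
apply/funext => N; rewrite /series /= mulr_suml; apply: eq_bigr => m _.
rewrite /order_part /path_sum mulr_suml; apply: eq_bigr => ls _.
by rewrite /at_vertex /coord; case: eqP => [<-|_]; rewrite ?mul1r ?mul0r// mulrC.
Qed.

(** * Average drift and the dynamical equation *)

Definition dyn_matrix t (i j : cell X n) : R :=
  \sum_(a : cell X n.+1)
    (incidence C a i)%:~R * (incidence C a j)%:~R * jump_rate beta D t a j.

Lemma dyn_opE t (q : chains X n R) i :
  dyn_op C beta D t q i = \sum_j dyn_matrix t i j * q j.
Proof.
rewrite /dyn_op ffunE.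
under [RHS]eq_bigr do rewrite mulr_suml.
rewrite exchange_big /=; apply: eq_bigr => a _.
rewrite !ffunE /inner mulr_sumr mulr_suml; apply: eq_bigr => j _.
rewrite !ffunE /jump_rate mulrBr expRD mulNr; ring.
Qed.

Lemma drift t w i :
  \sum_l flow t l w * ((val (step l w) i)%:~R - (val w i)%:~R) =
  - tauD D * \sum_j dyn_matrix t i j * (val w j)%:~R.
Proof.
pose F (a : cell X n.+1) (f : cell X n) : R :=
  tauD D * jump_rate beta D t a f * (incidence C a i)%:~R * (val w f)%:~R.
transitivity (- \sum_a \sum_f F a f * (incidence C a f)%:~R); last first.
  rewrite mulNr; congr (- _); rewrite exchange_big mulr_sumr; apply: eq_bigr => f _.
  rewrite mulr_suml mulr_sumr; apply: eq_bigr => a _; rewrite /F; ring.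
pose G (af : cell X n.+1 * cell X n) (e : signed_set S af.1 af.2) : R :=
  if (val w af.2 != 0) && (incidence C af.1 af.2 != 0)
  then F af.1 af.2 * (-1) ^+ chi S e else 0.
transitivity (- \sum_af \sum_(e : signed_set S af.1 af.2) G af e).
  rewrite (sig_big_dep xpredT (fun _ => xpredT) G) /= -sumrN.
  apply: eq_bigr => l _; rewrite val_step /flow /G /usable; case: ifPn => _.
    rewrite targetE /F rmorphB !rmorphM rmorphXn rmorphN1 /= mulr1n; ring.
  by rewrite mul0r oppr0.
congr (- _); rewrite pair_big /=; apply: eq_bigr => -[a f] _ /=.
have [ok|] := boolP ((val w f != 0) && (incidence C a f != 0)).
  rewrite (signed_setP S) rmorph_sum mulr_sumr; apply: eq_bigr => e _.
  by rewrite /G /= ok rmorphXn rmorphN1.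
(* Pairs that carry no edge also contribute nothing to H, since their term contains the vanishing
   coordinate or incidence number. *)
move=> no; rewrite big1 => [|e _]; last by rewrite /G /= (negbTE no).
move: no; rewrite negb_and !negbK => /orP[] /eqP zero; last by rewrite zero mulr0.
by rewrite /F zero mulr0 mul0r.
Qed.

Definition partial_mean N t i : R := series (fun m => path_sum (coord i) m t) N.

(** Words of length less than [N] contribute their full drift, the gains being counted at the next
    length. Words of length exactly [N] contribute only their loss, which is the error term. *)
Lemma partial_mean_derive N i t :
  is_derive t (1 : R) (fun s => partial_mean N.+1 s i)
    (- tauD D * \sum_j dyn_matrix t i j * partial_mean N t j
     - \sum_(ls <- paths S N) coord i ls * (outflow t (endpoint ls) * weight ls t)).
Proof.
elim: N => [|N IHN].
  rewrite (_ : (fun s => _) = path_sum (coord i) 0); last first.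
    by apply/funext => s; rewrite /partial_mean /series /= big_nat1.
  apply: (is_derive_eq (path_sum0_derive (coord i) t)).
  rewrite big_seq1 big1 ?mulr0 ?sub0r ?mulNr ?mulrN// => j _.
  by rewrite /partial_mean /series /= big_geq// mulr0.
have -> : (fun s => partial_mean N.+2 s i) =
    (fun s => partial_mean N.+1 s i) + path_sum (coord i) N.+1.
  apply/funext => s; rewrite /partial_mean /series /=.
  by rewrite big_nat_recr.
apply: (is_derive_eq (is_deriveD IHN (path_sumS_derive (coord i) N t))).
under [X in _ + (X + _) = _]eq_bigr => ls _ do rewrite mulNr mulrN.
rewrite sumrN [X in _ + X = _]addrC addrA; congr (_ - _).
rewrite -addrA [- _ + _]addrC -sumrB (eq_bigr (fun ls => weight ls t *
    (- tauD D * \sum_j dyn_matrix t i j * coord j ls))); last first.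
  move=> ls _; rewrite -drift /outflow mulr_suml !mulr_sumr -sumrB.
  by apply: eq_bigr => l _; rewrite /coord /=; ring.
under [X in _ + X = _]eq_bigr do rewrite mulrCA.
rewrite -mulr_sumr -mulrDr; congr (_ * _).
under [X in _ + X = _]eq_bigr do rewrite mulr_sumr.
rewrite exchange_big -big_split; apply: eq_bigr => j _.
rewrite /partial_mean [in RHS]/series /= big_nat_recr//= mulrDr; congr (_ + _).
by rewrite /path_sum mulr_sumr; apply: eq_bigr => ls _; ring.
Qed.

Lemma dyn_matrix_bounded : exists2 B : R, 0 <= B &
  forall t i j, `|dyn_matrix t i j| <= B.
Proof.
have [B B0 HB] := jump_rate_bounded beta D.
pose c : R := \sum_i \sum_j \sum_(a : cell X n.+1)
  `|(incidence C a i)%:~R * (incidence C a j)%:~R|.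
have c0 i j : 0 <= \sum_(a : cell X n.+1)
    `|(incidence C a i)%:~R * (incidence C a j)%:~R : R|.
  by apply: sumr_ge0.
exists (c * B) => [|t i j].
  apply: mulr_ge0; last exact: ltW.
  by apply: sumr_ge0 => i _; apply: sumr_ge0 => j _.
rewrite (le_trans (ler_norm_sum _ _ _))//.
apply: (@le_trans _ _ ((\sum_(a : cell X n.+1)
  `|(incidence C a i)%:~R * (incidence C a j)%:~R|) * B)).
  rewrite mulr_suml; apply: ler_sum => a _.
  by rewrite normrM ler_wpM2l// ger0_norm ?expR_ge0.
apply: ler_wpM2r; first exact: ltW.
rewrite /c (bigD1 i)//= [X in _ <= X + _](bigD1 j)//= -addrA lerDl addr_ge0//.
  by apply: sumr_ge0.
by apply: sumr_ge0 => i' _; apply: sumr_ge0.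
Qed.

Definition mean t : chains X n R := vertex_expectation (path_solution t).

Lemma mean_derive t i :
  is_derive t (1 : R) (fun s => mean s i) (- tauD D * dyn_op C beta D t (mean t) i).
Proof.
have [V [lam [V0 HV]]] := path_sums_dominated.
have [B B0 HB] := dyn_matrix_bounded.
have [K K0 HK] := outflow_bounded S z0 beta D.
apply: (is_derive1_lim (f := fun N s => partial_mean N.+1 s i)
   (f' := fun N s => - tauD D * \sum_j dyn_matrix s i j * partial_mean N s j
     - \sum_(ls <- paths S N) coord i ls * (outflow s (endpoint ls) * weight ls s))
   (g' := fun s => - tauD D * dyn_op C beta D s (mean s) i)).
- by move=> N s; exact: partial_mean_derive.
- move=> s; rewrite (cvg_shiftS (fun N => partial_mean N s i)).
  exact: (path_solution_expectation s).2.
move=> T e e0.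
pose c := V * expR (`|lam| * T).
(* The first summand bounds the tail of the mean under tau_D H, the second the loss from the longest
   words; both come with the factor 2^(-N), uniformly for |t| <= T. *)
pose M := tauD D * (B * (2 * c) *+ #|cell X n|) + K * c.
have M0 : (fun N => M * 2^-1 ^+ N) @ \oo --> 0.
  by apply: cvg_geometric; rewrite ger0_norm ?invf_lt1 ?ltr1n.
have /cvgrPdist_le /(_ e e0) := M0; apply: filterS => N; rewrite sub0r normrN => MN s sT.
apply: (@le_trans _ _ (M * 2^-1 ^+ N)); last exact: le_trans (ler_norm _) MN.
have cE : V * expR (lam * `|s|) <= c.
  rewrite /c ler_wpM2l// ler_expR (le_trans (ler_norm _))// normrM normr_id.
  by rewrite ler_wpM2l.
have N20 : 0 <= 2^-1 ^+ N :> R by rewrite exprn_ge0.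
rewrite dyn_opE addrAC -mulrBr -sumrB.
rewrite (le_trans (ler_normB _ _))// /M mulrDl lerD//.
  rewrite normrM normrN (gtr0_norm (tauD_gt0 D)) -mulrA ler_pM2l ?tauD_gt0//.
  rewrite (le_trans (ler_norm_sum _ _ _))// -sumr_const mulr_suml.
  apply: ler_sum => j _; rewrite -mulrBr normrM -mulrA ler_pM// distrC.
  apply: le_trans (@geometric_series_tail _ _ (V * expR (lam * `|s|)) _ _ _ N) _.
  - by move=> m; exact: le_trans (ler_norm_sum _ _ _) ((HV m s).2 j).
  - exact: (path_solution_expectation s).2.
  - by rewrite ler_wpM2r// ler_wpM2l.
rewrite (le_trans (ler_norm_sum _ _ _))// -mulrA.
apply: (@le_trans _ _ (K * \sum_(ls <- paths S N) `|coord i ls * weight ls s|)).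
  rewrite mulr_sumr; apply: ler_sum => ls _.
  rewrite mulrCA normrM ler_wpM2r// ger0_norm//.
  by apply: sumr_ge0 => l _; exact: flow_ge0.
apply: ler_wpM2l; first exact: ltW.
by apply: le_trans ((HV N s).2 i) _; rewrite ler_wpM2r.
Qed.

Lemma dynamical_solution_uniq q q' :
  dynamical_solution C beta D z0 q -> dynamical_solution C beta D z0 q' -> q = q'.
Proof.
move=> [q0 dq] [q'0 dq']; have [B B0 HB] := dyn_matrix_bounded.
apply/funext => t; apply/ffunP => i; apply/eqP; rewrite -subr_eq0; apply/eqP.
apply: (@linear_system_uniq R _ (fun s i j => - tauD D * dyn_matrix s i j) (tauD D * B)
  (fun s i => q s i - q' s i)).
- move=> s i' j; rewrite normrM normrN (gtr0_norm (tauD_gt0 D)).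
  by rewrite ler_pM2l ?tauD_gt0.
- move=> s i'; apply: (is_derive_eq (is_derive1_sub (dq s i') (dq' s i'))).
  rewrite !dyn_opE -mulrBr -sumrB mulr_sumr; apply: eq_bigr => j _; ring.
- by move=> i'; rewrite q0 q'0 subrr.
Qed.

Lemma mean_unique : unique (dynamical_solution C beta D z0) mean.
Proof.
suff sol : dynamical_solution C beta D z0 mean.
  by split=> // q; exact: dynamical_solution_uniq.
split; last by move=> t j; exact: mean_derive.
apply/ffunP => j; rewrite [RHS]ffunE.
(* At time 0 only the empty word has nonzero weight. *)
have : series (fun m => path_sum (coord j) m 0) @ \oo -->
      ((z0 j)%:~R : R).
  apply: cvg_near_cst; exists 1%N => // -[|N] _ //=.
  rewrite /series /= big_nat_recl// big1 => [|m _].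
    rewrite addr0 /path_sum big_seq1 (weight_nil S z0 beta D).1 mulr1.
    by rewrite /coord /=.
  rewrite /path_sum sum_pathsS big1// => ls _; rewrite big1// => l _.
  by rewrite (weight_cons z0 beta D l ls).1 mulr0.
by apply: (cvg_unique _ ((path_solution_expectation 0).2 j)).
Qed.

End Expansion.

(** In degree 0 every chain is a cycle. In positive degree the right-hand side is a boundary, so the
    boundary of the solution has zero derivative and keeps its initial value 0. *)
Lemma dynamical_solution_cycles (R : realType) (n : nat) (X : finCW R n.+1)
    (C : cellular_complex X) (beta : R) (D : driving_protocol X)
    (z0 : chains X n int) (q : R -> chains X n R) :
  cycles C int n z0 -> dynamical_solution C beta D z0 q ->
  forall t, cycles C R n (q t).
Proof.
case: n X C D z0 q => // n X C D z0 q /= hz0 [q0 dq] t.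
apply/ffunP => i; rewrite !ffunE.
pose b (s : R) := \sum_(a : cell X n.+1) q s a * (incidence C a i)%:~R.
have db s : is_derive s (1 : R) b 0.
  have dbs := is_derive1_sum (index_enum _) (fun a =>
    is_derive1_mul (dq s a) (is_derive_cst ((incidence C a i)%:~R : R) s 1)).
  apply: (is_derive_eq dbs).
  under eq_bigr => a _ do
    rewrite mulr0 add0r mulrCA /dyn_op ffunE mulr_sumr.
  rewrite -mulr_sumr exchange_big /= big1 ?mulr0// => a' _.
  under eq_bigr do rewrite mulrCA -intrM [X in _ * X%:~R]mulrC.
  rewrite -mulr_sumr -rmorph_sum /=.
  by rewrite incidence_incidence mulr0.
rewrite -/(b t) (is_derive_0_is_cst t 0 db) /b q0.
move/ffunP/(_ i): hz0; rewrite !ffunE => hz0i.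
under eq_bigr do rewrite ffunE -intrM.
rewrite -rmorph_sum /=; under eq_bigr do rewrite -[X in _ * X]intz.
by rewrite hz0i.
Qed.

Theorem theorem1 (R : realType) (n : nat) (X : finCW R n.+1)
    (C : cellular_complex X) (S : signed_sets C) (z0 : chains X n int)
    (beta : R) (D : driving_protocol X)
    (hX : connected [set: X]) (hz0 : cycles C int n z0) (hbeta : 0 < beta) :
  exists rho : R -> vertex_distribution S z0,
    unique (formal_solution beta D) rho /\
    [/\ forall t, expectation_summable (rho t),
        forall t, cycles C R n (vertex_expectation (rho t)) &
        unique (dynamical_solution C beta D z0)
          (fun t => vertex_expectation (rho t))].
Proof.
exists (@path_solution R n X C S z0 beta D); split; first exact: path_solution_unique.
split=> [t|t|]; last exact: mean_unique.
  exact: (path_solution_expectation _ _ _ _ t).1.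
exact: (dynamical_solution_cycles hz0 (mean_unique S z0 beta D).1).
Qed.
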